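(* Let $B$ be a finite connected CW left regular band. Then each open interval of $\Lambda(B)$ is a Cohen–Macaulay poset. In particular, if $B$ is a monoid, then the proper part $\Lambda(B)\setminus\{\hat0,\hat1\}$ of $\Lambda(B)$ is Cohen–Macaulay.
   Context: A left regular band is a finite semigroup $B$ with $x^2=x$, $xyx=xy$, ordered by $a\le b$ iff $ba=a$; $\Lambda(B)=\{Bb\}$ ordered by inclusion, with minimum $\hat0$ and (when $B$ is a monoid) maximum $\hat1=B$; $B_{\ge X}=\{b\mid Bb\supseteq X\}$; $B$ is connected if each order complex $\Delta(B_{\ge X})$ is connected. A CW poset is a finite graded poset $P$ such that the realization of $\Delta(P_{<p})$ is a sphere of dimension $\dim\Delta(P_{\le p})-1$; $B$ is a CW left regular band if every $B_{\ge X}$ is a CW poset. A poset is Cohen–Macaulay if its order complex $K$ is Cohen–Macaulay over $\mathbb{Z}$: for every simplex $\sigma$ of $K$ (including the empty one), $\tilde H_q(\mathrm{lk}_K(\sigma);\mathbb{Z})=0$ for all $q<\dim\mathrm{lk}_K(\sigma)$. *)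

(* Defs.v *)
From HB Require Import structures.
From mathcomp Require Import all_boot all_order all_algebra.
From mathcomp Require Import all_classical all_reals all_analysis.

Set Implicit Arguments.
Unset Strict Implicit.
Unset Printing Implicit Defensive.

Import Order.TTheory GRing.Theory Num.Theory.
Import numFieldNormedType.Exports.

(* Throughout, [{set T}] is the finite sets of finset.v, and [set T] the
   classical sets of mathcomp-analysis; [%SET] and [%classic] disambiguate
   their comprehensions. *)

(** * Left regular bands *)

(* The order is part of the structure, but the axiom [lrb_leE] determines it
   from the product; the factory [Semigroup_isLRB] below builds it. *)
HB.mixin Record SemigroupPOrder_isLRB (d : Order.disp_t) B
    of Semigroup B & Order.POrder d B := {
  lrb_mulxx : forall x : B, (x * x)%g = x;
  lrb_mulxyx : forall x y : B, (x * y * x)%g = (x * y)%g;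
  lrb_leE : forall a b : B, (a <= b)%O = ((b * a)%g == a) }.

#[short(type="finLRBType")]
HB.structure Definition FinLRB (d : Order.disp_t) :=
  { B of Semigroup B & Order.FinPOrder d B & SemigroupPOrder_isLRB d B }.

HB.factory Record Semigroup_isLRB (d : Order.disp_t) B
    of Finite B & Semigroup B := {
  mulxx : forall x : B, (x * x)%g = x;
  mulxyx : forall x y : B, (x * y * x)%g = (x * y)%g }.

HB.builders Context d B of Semigroup_isLRB d B.

Let le (a b : B) := (b * a)%g == a.

Fact le_refl : reflexive le.
Proof. by move=> a; rewrite /le mulxx. Qed.

Fact le_anti : antisymmetric le.
Proof.
move=> a b /andP[/eqP ba /eqP ab].
by rewrite -ba -{1}ab mulxyx ab.
Qed.

Fact le_trans : transitive le.
Proof. by move=> b a c /eqP ba /eqP cb; rewrite /le -ba mulgA cb. Qed.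

HB.instance Definition _ := Order.Le_isPOrder.Build d B le_refl le_anti le_trans.

HB.instance Definition _ :=
  SemigroupPOrder_isLRB.Build d B mulxx mulxyx (fun _ _ => erefl).

HB.end.

Definition left_ideal d (B : finLRBType d) (b : B) : {set B} :=
  [set (x * b)%g | x in [set: B]%SET]%SET.

(* The poset Lambda(B) of principal left ideals, ordered by inclusion. *)
Record Lambda d (B : finLRBType d) : Type := MkLambda {
  Lambda_set :> {set B};
  _ : Lambda_set \in [set left_ideal b | b in [set: B]%SET]%SET }.

HB.instance Definition _ d (B : finLRBType d) :=
  [isSub for @Lambda_set d B].
HB.instance Definition _ d (B : finLRBType d) := [Finite of Lambda B by <:].

Fact Lambda_display : Order.disp_t.
Proof. exact: Order.Disp tt tt. Qed.

Section LambdaOrder.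
Variables (d : Order.disp_t) (B : finLRBType d).

Let le (X Y : Lambda B) := X \subset Y.

Fact Lambda_le_refl : reflexive le.
Proof. by move=> X; exact: subxx. Qed.

Fact Lambda_le_anti : antisymmetric le.
Proof. by move=> X Y XY; apply/val_inj/eqP; rewrite finset.eqEsubset. Qed.

Fact Lambda_le_trans : transitive le.
Proof. by move=> Y X Z; exact: fintype.subset_trans. Qed.

HB.instance Definition _ := Order.Le_isPOrder.Build Lambda_display (Lambda B)
  Lambda_le_refl Lambda_le_anti Lambda_le_trans.
End LambdaOrder.

Definition LRB_ge d (B : finLRBType d) (X : Lambda B) : {set B} :=
  [set b : B | X \subset left_ideal b]%SET.

(** * Finite simplicial complexes *)

(* A complex is given by its set of simplices, the empty one included; not
   every element of the ambient type [V] need be a vertex. *)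
Section Complexes.
Variable V : finType.
Implicit Types (K : {set {set V}}) (s : {set V}).
Local Open Scope ring_scope.

Definition dim_complex K : int := (\max_(s in K) #|s|)%N%:Z - 1.

Definition link K s : {set {set V}} :=
  [set t : {set V} | [disjoint t & s] && (s :|: t \in K)]%SET.

Definition pure K : Prop :=
  forall s t, maxset [in K] s -> maxset [in K] t -> #|s| = #|t|.

(* Points are given by their barycentric coordinates. *)
Definition realization (R : realType) K : set 'rV[R]_#|V| :=
  [set x : 'rV[R]_#|V| | [/\ forall i, 0 <= x ord0 i, \sum_i x ord0 i = 1 &
     [set v : V | x ord0 (enum_rank v) != 0]%SET \in K]]%classic.

(* Augmented integral chains: a simplex has dimension one less than its
   cardinal, so that the empty simplex spans the chains of degree -1. *)
Definition is_chain K (q : int) (c : {ffun {set V} -> int}) : Prop :=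
  forall s, c s != 0 -> s \in K /\ #|s|%:Z = q + 1.

(* Simplices are oriented by the enumeration order of [V]; the coefficient of
   [t] in the boundary of [v |: t] is (-1)^i, where [v] is the i-th vertex of
   [v |: t]. *)
Definition boundary (c : {ffun {set V} -> int}) : {ffun {set V} -> int} :=
  [ffun t : {set V} => \sum_(v : V | v \notin t)
     (-1) ^+ #|[set u in t | (enum_rank u < enum_rank v)%N]%SET| * c (v |: t)%SET].

Definition reduced_homology_vanishes K (q : int) : Prop :=
  forall c, is_chain K q c -> boundary c = 0 ->
  exists2 b, is_chain K (q + 1) b & boundary b = c.

Definition Cohen_Macaulay_complex K : Prop :=
  forall s, s \in K -> forall q : int, q < dim_complex (link K s) ->
  reduced_homology_vanishes (link K s) q.

End Complexes.

Arguments realization {V} R K.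

(** * Spheres *)

Section Spheres.
Local Open Scope classical_set_scope.
Local Open Scope ring_scope.

Definition homeomorphic (T U : topologicalType) (A : set T) (B : set U) : Prop :=
  exists (f : T -> U) (g : U -> T),
    [/\ {within A, continuous f}, {within B, continuous g},
        (forall x, A x -> B (f x) /\ g (f x) = x) &
        (forall y, B y -> A (g y) /\ f (g y) = y)].

(* The sphere of dimension n - 1; it is empty for n = 0. *)
Definition unit_sphere (R : realType) (n : nat) : set 'rV[R]_n :=
  [set x : 'rV[R]_n | \sum_i x ord0 i ^+ 2 = 1]%classic.

Arguments unit_sphere : clear implicits.

Definition is_sphere (R : realType) (k : int) (T : topologicalType) (A : set T)
    : Prop :=
  exists2 n : nat, n%:Z = k + 1 & homeomorphic A (unit_sphere R n).

End Spheres.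

(** * Posets *)

(* A finite poset is a subset [P] of a [finPOrderType], with the induced
   order. *)
Section Posets.
Variables (d : Order.disp_t) (T : finPOrderType d).
Implicit Type P : {set T}.
Local Open Scope order_scope.

Definition order_complex P : {set {set T}} :=
  [set s : {set T} | (s \subset P) && [forall x in s, forall y in s, x >=< y]]%SET.

Definition lower_le P (p : T) : {set T} := [set x in P | x <= p]%SET.

Definition lower_lt P (p : T) : {set T} := [set x in P | x < p]%SET.

(* Maximal chains of P_{<= p} all have the same length, for every p: P has a
   rank function, but its maximal elements may have different ranks. *)
Definition graded P : Prop :=
  forall p, p \in P -> pure (order_complex (lower_le P p)).

Definition CW_poset (R : realType) P : Prop :=
  graded P /\
  forall p, p \in P ->
    is_sphere R (dim_complex (order_complex (lower_le P p)) - 1)%R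
      (realization R (order_complex (lower_lt P p))).

Definition Cohen_Macaulay P : Prop := Cohen_Macaulay_complex (order_complex P).

Definition open_interval (x y : T) : {set T} := [set z : T | x < z < y]%SET.

(* The poset with its minimum and its maximum removed (if it has any). *)
Definition proper_part : {set T} :=
  [set z : T | ~~ [forall x, z <= x] && ~~ [forall x, x <= z]]%SET.

End Posets.

Arguments proper_part {d} T.

(** * CW left regular bands *)

Definition LRB_connected (R : realType) d (B : finLRBType d) : Prop :=
  forall X : Lambda B, connected (realization R (order_complex (LRB_ge X))).

Definition CW_LRB (R : realType) d (B : finLRBType d) : Prop :=
  forall X : Lambda B, CW_poset R (LRB_ge X).

(* Main.v *)
(* Let X < Y in Lambda(B), and choose y with By = Y. The map b |-> Bb sends
   P = {b < y | X < Bb} to the open interval (X, Y), and its fibre over [Z, Y)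
   is (B_{>=Z})_{<y}, which is a sphere by the CW hypothesis. These fibres are
   acyclic below their dimensions, so that acyclic carriers provide a section up
   to homotopy of the chain map of P -> (X, Y) in low degrees: it is enough to
   show that the cycles of P of low degree bound. Now P is the sphere
   (B_{>=X})_{<y} without the antichain of the b with Bb = X, and Mayer-Vietoris
   reduces the acyclicity of P to that of the sphere and of the sphere minus
   the open star of a vertex. Finally, the links in (X, Y) are joins of open
   intervals.

   The only topological input is that a complex homeomorphic to a sphere becomes
   acyclic when the open star of a nonempty simplex is deleted. The realization
   of the deletion is a retract of a compact convex set, by stereographic
   projection from the barycenter of the simplex. A simplicial cycle is
   subdivided into a chain of sequences of close points, which is coned off in
   the convex set and retracted, and the points are finally replaced by vertices
   at which their barycentric coordinate is large. *)

From HB Require Import structures.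
Require Import Defs.
From mathcomp Require Import all_boot all_order all_algebra.
From mathcomp Require Import all_classical all_reals all_analysis.
From mathcomp Require Import ssrAC freeg ring lra.

Set Implicit Arguments.
Unset Strict Implicit.
Unset Printing Implicit Defensive.

Import Order.TTheory GRing.Theory Num.Theory.
Import numFieldNormedType.Exports.


(** * Chains on sequences of vertices *)

(** All complexes are spanned by sequences of vertices and cut out by predicates. Points of
    Euclidean space, elements of the band and elements of the lattice are thus treated alike, and no
    orientation is chosen before the comparison with [boundary]. The dimensions of the spheres are
    never compared. A simplex with more than k vertices already forces the cycles on k vertices to
    bound, so every vanishing range is witnessed by a chain of the lattice, lifted to B by z |-> y *
    z. Hence [spherical] speaks of an arbitrary chain. Removing the antichain costs one degree
    altogether, not one for each vertex: no simplex has two vertices in an antichain, so the two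
    subcomplexes of each Mayer-Vietoris step have the whole sphere as their union. The lost degree
    is regained because the lift of a chain of (X, Y) can be prolonged by a lift of X itself. Moving
    sequences of close points requires uniform continuity, hence compactness; this is why the convex
    set is a ball of the hyperplane and not the hyperplane itself. *)

Section Linear.
Local Open Scope ring_scope.
Variables (K : choiceType) (M : lmodType int).
Implicit Types (f g : K -> M) (c : {freeg K / int}) (S : K -> Prop).

Definition lin f : {freeg K / int} -> M := fglift f.

HB.instance Definition _ f :=
  GRing.isZmodMorphism.Build {freeg K / int} M (lin f) (lift_is_additive f).

Lemma lin_gen f k s : lin f << k *g s >> = k *: f s.
Proof. exact: liftU. Qed.

Lemma lin1 f s : lin f << s >> = f s.
Proof. by rewrite lin_gen scale1r. Qed.

(** Subcomplexes are predicates on the generators of one ambient free group, so that inclusions are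
    identities, and intersections and unions are [/\] and [\/]. *)
Definition supported S c := forall s, coeff s c != 0 -> S s.

Lemma supported0 S : supported S 0.
Proof. by move=> s; rewrite coeff0 eqxx. Qed.

Lemma supportedD S c c' : supported S c -> supported S c' -> supported S (c + c').
Proof.
move=> Sc Sc' s; rewrite coeffD; have [->|/Sc //] := eqVneq (coeff s c) 0.
by rewrite add0r => /Sc'.
Qed.

Lemma supportedN S c : supported S c -> supported S (- c).
Proof. by move=> Sc s; rewrite coeffN oppr_eq0 => /Sc. Qed.

Lemma supportedB S c c' : supported S c -> supported S c' -> supported S (c - c').
Proof. by move=> Sc Sc'; apply: supportedD => //; apply: supportedN. Qed.

Lemma supported_gen S k s : S s -> supported S << k *g s >>.
Proof.
move=> Ss t; rewrite coeffU; have [<- //|] := eqVneq s t.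
by rewrite mulr0 => _ /eqP.
Qed.

Lemma supportedZ S k c : supported S c -> supported S (k *: c).
Proof. by move=> Sc s; rewrite coeffZ mulf_eq0 negb_or => /andP[_ /Sc]. Qed.

Lemma sub_supported S S' c :
  supported S c -> (forall s, S s -> S' s) -> supported S' c.
Proof. by move=> Sc SS' s /Sc/SS'. Qed.

Lemma supported_ind S (P : {freeg K / int} -> Prop) :
  P 0 -> (forall k s c, S s -> P c -> P (<< k *g s >> + c)) ->
  forall c, supported S c -> P c.
Proof.
move=> P0 PS c Sc; rewrite -[c]freeg_sumE.
have: all (fun z => coeff z c != 0) (dom c).
  by apply/allP => z; rewrite mem_dom.
elim: (dom c) => [|z r IHr]; first by rewrite big_nil.
by move=> /= /andP[/Sc Sz /IHr]; rewrite big_cons; apply: PS.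
Qed.

Lemma supported_split S S' c : supported (fun s => S s \/ S' s) c ->
  exists c1 c2, [/\ c = c1 + c2, supported S c1 & supported S' c2].
Proof.
move: c; apply: supported_ind; first by exists 0, 0; rewrite addr0; split=> //; apply: supported0.
move=> k s c Ss [c1 [c2 [-> S1 S2]]]; case: Ss => Ss.
  by exists (<<k *g s>> + c1), c2; rewrite addrA; split=> //; apply: supportedD => //;
    apply: supported_gen.
by exists c1, (<<k *g s>> + c2); rewrite addrCA; split=> //; apply: supportedD => //;
  apply: supported_gen.
Qed.

Lemma eq_lin S f g c : supported S c -> (forall s, S s -> f s = g s) -> lin f c = lin g c.
Proof.
move=> Sc fg; move: c Sc; apply: supported_ind; first by rewrite !raddf0.
by move=> k s c Ss IH; rewrite !raddfD /= !lin_gen fg // IH.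
Qed.

Lemma lin_cst0 c : lin (fun=> 0) c = 0.
Proof.
elim/freeg_ind_dom0: c => [|k s c _ _ IH]; first by rewrite raddf0.
by rewrite raddfD /= lin_gen scaler0 IH addr0.
Qed.

Lemma linDf f g c : lin (fun s => f s + g s) c = lin f c + lin g c.
Proof.
elim/freeg_ind_dom0: c => [|k s c _ _ IH]; first by rewrite !raddf0 addr0.
by rewrite !raddfD /= !lin_gen scalerDr IH addrACA.
Qed.

Lemma linZf f a c : lin (fun s => a *: f s) c = a *: lin f c.
Proof.
elim/freeg_ind_dom0: c => [|k s c _ _ IH]; first by rewrite !raddf0.
by rewrite !raddfD /= !lin_gen IH !scalerA mulrC.
Qed.

Lemma linNf f c : lin (fun s => - f s) c = - lin f c.
Proof.
elim/freeg_ind_dom0: c => [|k s c _ _ IH]; first by rewrite !raddf0.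
by rewrite !raddfD /= !lin_gen IH scalerN.
Qed.

Lemma linBf f g c : lin (fun s => f s - g s) c = lin f c - lin g c.
Proof. by rewrite linDf linNf. Qed.

Fact lin_scalable f : scalable (lin f).
Proof.
move=> a c; elim/freeg_ind_dom0: c => [|k s c _ _ IH]; first by rewrite !(raddf0, scaler0).
rewrite scalerDr !raddfD /= IH lin_gen scalerA -lin_gen; congr (lin f _ + _).
by apply/eqP/freeg_eqP => t; rewrite coeffZ !coeffU mulrA.
Qed.

HB.instance Definition _ f :=
  GRing.isScalable.Build int {freeg K / int} M *:%R (lin f) (lin_scalable f).

End Linear.

Lemma freeg_scale (K : choiceType) (k : int) (s : K) :
  (<< k *g s >> = k *: << s >>)%R.
Proof. by apply/eqP/freeg_eqP => t; rewrite coeffZ !coeffU mul1r. Qed.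

Section LinearComp.
Local Open Scope ring_scope.
Variables (K L : choiceType) (M : lmodType int).

Lemma lin_comp (f : L -> M) (g : K -> {freeg L / int}) c :
  lin f (lin g c) = lin (fun s => lin f (g s)) c.
Proof.
elim/freeg_ind_dom0: c => [|k s c _ _ IH]; first by rewrite !raddf0.
by rewrite !raddfD /= !lin_gen linearZ IH.
Qed.

Lemma lin_id (c : {freeg K / int}) : lin (fun s => << s >>) c = c.
Proof.
elim/freeg_ind_dom0: c => [|k s c _ _ IH]; first by rewrite raddf0.
by rewrite raddfD /= lin_gen IH -freeg_scale.
Qed.

Lemma supported_lin (S : K -> Prop) (T : L -> Prop) f c :
  supported S c -> (forall s, S s -> supported T (f s)) ->
  supported T (lin f c : {freeg L / int}).
Proof.
move=> Sc Tf; move: c Sc; apply: supported_ind.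
  by rewrite raddf0; apply: supported0.
move=> k s c Ss IH; rewrite raddfD /= lin_gen; apply: supportedD => //.
by apply: supportedZ; apply: Tf.
Qed.

End LinearComp.

Notation chain V := {freeg (seq V) / int}.

Section Boundary.
Local Open Scope ring_scope.
Variable V : choiceType.
Implicit Types (s t : seq V) (c : chain V) (S : seq V -> Prop).

Definition cone (v : V) : chain V -> chain V := lin (fun t => << v :: t >>).

HB.instance Definition _ v := GRing.Linear.on (cone v).

(** The alternating sum of the faces, in the form d(v t) = t - v d(t): inductions on the sequence
    then need neither positions nor signs. *)
Fixpoint face_sum s : chain V :=
  if s is v :: t then << t >> - cone v (face_sum t) else 0.

Definition bd : chain V -> chain V := lin face_sum.

HB.instance Definition _ := GRing.Linear.on bd.

Lemma bd1 s : bd << s >> = face_sum s.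
Proof. exact: lin1. Qed.

Lemma cone1 v s : cone v << s >> = << v :: s >>.
Proof. exact: lin1. Qed.

Lemma bd_cone v c : bd (cone v c) = c - cone v (bd c).
Proof.
elim/freeg_ind_dom0: c => [|k s c _ _ IH]; first by rewrite !raddf0 ?addr0.
rewrite freeg_scale !(linearD, linearZ) /= IH cone1 !bd1 /= scalerDr !addrA; congr (_ + _).
by rewrite -!addrA; congr (_ + _); rewrite addrC.
Qed.

Lemma bd_bd c : bd (bd c) = 0.
Proof.
rewrite /bd lin_comp -[RHS](lin_cst0 _ c); congr (lin _ c); apply/funext => s.
elim: s => [|v t IHt] /=; first by rewrite raddf0.
by rewrite -/(bd _) linearB /= bd1 bd_cone [bd (face_sum t)]IHt raddf0 subr0 subrr.
Qed.

Definition closed_under_faces S := forall s t, subseq t s -> S s -> S t.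

(* Degrees are numbers of vertices: the empty sequence provides the
   augmentation. *)
Definition sized S k s := S s /\ size s = k.

Lemma supported_face_sum s :
  supported (fun t => subseq t s /\ (size t).+1 = size s) (face_sum s).
Proof.
elim: s => [|v s IHs] /=; first exact: supported0.
apply: supportedB.
  by apply: supported_gen; split=> //; exact: (subseq_cons s v).
apply: supported_lin IHs _ => t [ts szt]; apply: supported_gen.
by rewrite /= eqxx ts szt.
Qed.

Arguments supported_face_sum : clear implicits.

Lemma supported_bd S k c : closed_under_faces S ->
  supported (sized S k.+1) c -> supported (sized S k) (bd c).
Proof.
move=> clS Sc; apply: supported_lin Sc _ => s [Ss szs].
apply: sub_supported (supported_face_sum s) _ => t [ts]; rewrite szs => -[szt].
by split=> //; apply: clS Ss.
Qed.

(** For [S] inside [S'], the inclusion induces zero in homology. Two predicates are needed because a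
    cycle of very close points will only be filled by points that are less close. *)
Definition bounds S S' k := forall c, supported (sized S k) c -> bd c = 0 ->
  exists2 b, supported (sized S' k.+1) b & bd b = c.

Definition acyclic_at S k := bounds S S k.

Lemma acyclic_cone S v k : closed_under_faces S ->
  (forall t, S t -> S (v :: t)) -> acyclic_at S k.
Proof.
move=> clS Sv c Sc bdc; exists (cone v c); last by rewrite bd_cone bdc raddf0 subr0.
apply: supported_lin Sc _ => s [Ss szs]; apply: supported_gen.
by split; [apply: Sv|rewrite /= szs].
Qed.

(* For chains without repetition the cone has to kill the simplices through
   its apex. *)
Lemma acyclic_strict_cone S v k : closed_under_faces S ->
  (forall t, S t -> v \notin t -> S (v :: t)) ->
  (forall t, S t -> v \in t -> exists2 t', t = v :: t' & v \notin t') ->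
  acyclic_at S k.
Proof.
move=> clS Sv Sv'.
pose h t : chain V := if v \in t then 0 else << v :: t >>.
have hcone c : supported (fun t => v \in t) c -> lin h c = 0.
  move=> vc; rewrite -[RHS](lin_cst0 _ c); apply: eq_lin vc _ => t vt.
  by rewrite /h vt.
have hnot c : supported (fun t => v \notin t) c -> lin h c = cone v c.
  by move=> vc; apply: eq_lin vc _ => t vt; rewrite /h (negbTE vt).
have fsn t : v \notin t -> supported (fun t => v \notin t) (face_sum t).
  move=> vt; apply: sub_supported (supported_face_sum t) _ => u [/mem_subseq ut _].
  by apply: contra vt; apply: ut.
have key t : S t -> bd (h t) + lin h (face_sum t) = << t >>.
  move=> St; rewrite {1}/h; case: ifPn => vt.
    (* Here d(v t') = t' - v d(t'): [h] sends t' to v t' and kills the other term, all of whose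
       simplices contain v. *)
    have [t' -> vt'] := Sv' _ St vt.
    rewrite raddf0 add0r /= raddfB /= lin1 {1}/h (negbTE vt').
    rewrite [X in _ - X]hcone ?subr0 // /cone.
    apply: supported_lin (supported_face_sum t') _ => u _.
    by apply: supported_gen; rewrite inE eqxx.
  by rewrite bd1 /= hnot ?subrK //; apply: fsn.
move=> c Sc bdc; exists (lin h c).
  apply: supported_lin Sc _ => t [St szt]; rewrite /h; case: ifPn => vt.
    exact: supported0.
  by apply: supported_gen; split; [apply: Sv|rewrite /= szt].
have := lin_id c; rewrite -[in LHS](@eq_lin _ _ _ _ _ c Sc (fun t St => key t (proj1 St))).
by rewrite linDf -!lin_comp -/(bd _) -/(bd c) bdc raddf0 addr0.
Qed.

(** The two fillings of a cycle, in [S] and in [S'], differ by the boundary of a chain of the union.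
    Splitting this chain and moving one half to the other side of the equation gives a filling that
    lies both in [S] and in [S']. *)
Lemma Mayer_Vietoris S S' k :
  closed_under_faces S -> closed_under_faces S' ->
  acyclic_at S k -> acyclic_at S' k ->
  acyclic_at (fun s => S s \/ S' s) k.+1 ->
  acyclic_at (fun s => S s /\ S' s) k.
Proof.
move=> clS clS' aS aS' aU c Sc bdc.
have [b Sb bdb] : exists2 b, supported (sized S k.+1) b & bd b = c.
  by apply: aS => //; apply: sub_supported Sc _ => s [[]].
have [b' Sb' bdb'] : exists2 b, supported (sized S' k.+1) b & bd b = c.
  by apply: aS' => //; apply: sub_supported Sc _ => s [[]].
have [e Se bde] : exists2 e,
    supported (sized (fun s => S s \/ S' s) k.+2) e & bd e = b - b'.
  apply: aU; last by rewrite raddfB /= bdb bdb' subrr.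
  by apply: supportedB; [apply: sub_supported Sb _|apply: sub_supported Sb' _] => s [Ss ?]; split; auto.
have [e1 [e2 [ee1e2 Se1 Se2]]] : exists e1 e2, [/\ e = e1 + e2,
    supported (sized S k.+2) e1 & supported (sized S' k.+2) e2].
  by apply: supported_split; apply: sub_supported Se _ => s [[] Ss szs]; [left|right].
have eqb : b - bd e1 = b' + bd e2.
  move: bde; rewrite ee1e2 raddfD /= => bde.
  by apply/eqP; rewrite subr_eq -addrA [bd e2 + _]addrC bde subrKC.
have Sb1 : supported (sized S k.+1) (b - bd e1).
  by apply: supportedB => //; apply: supported_bd.
have Sb1' : supported (sized S' k.+1) (b - bd e1).
  by rewrite eqb; apply: supportedD => //; apply: supported_bd.
exists (b - bd e1); last by rewrite raddfB /= bd_bd subr0.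
by move=> s sb; have [Ss szs] := Sb1 s sb; have [Ss' _] := Sb1' s sb.
Qed.

End Boundary.
Arguments supported_face_sum {V}.

(** * Acyclic carriers *)

Section Carriers.
Local Open Scope ring_scope.

Definition monotone_carrier (V W : choiceType) (S : seq V -> Prop)
    (Car : seq V -> seq W -> Prop) :=
  forall s t u, S s -> subseq t s -> Car t u -> Car s u.

(* Acyclic carriers: [phi = 0], [eps = 1], [r = 0] builds chain maps, and
   [eps = -1], [r = 1] builds chain homotopies. *)
Lemma carrier_extend (V W : choiceType) (S : seq V -> Prop)
    (Car : seq V -> seq W -> Prop) (r : nat) (eps : int)
    (phi : seq V -> chain W) (f0 : chain W) (N : nat) :
  eps * eps = 1 -> closed_under_faces S -> monotone_carrier S Car ->
  (forall s, S s -> (0 < size s <= N)%N ->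
     supported (sized (Car s) ((size s).-1 + r)%N) (phi s)) ->
  (forall s, S s -> (0 < size s <= N)%N ->
     bd (phi s) + eps *: lin phi (face_sum s) = 0) ->
  (forall s, S s -> (0 < size s <= N)%N ->
     acyclic_at (Car s) ((size s).-1 + r)%N) ->
  (S [::] -> supported (sized (Car [::]) r) f0 /\ bd f0 = phi [::]) ->
  exists2 f, f [::] = f0 & forall s, S s -> (size s <= N)%N ->
    supported (sized (Car s) (size s + r)%N) (f s) /\
    bd (f s) = phi s + eps *: lin f (face_sum s).
Proof.
move=> eps2 clS monC sphi bphi acyC Hf0.
elim: N sphi bphi acyC => [|N IHN] sphi bphi acyC.
  exists (fun=> f0) => // s Ss; rewrite leqn0 size_eq0 => /eqP s0; subst s.
  by have [? ->] := Hf0 Ss; rewrite /= raddf0 scaler0 addr0 add0n.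
case: IHN => [s Ss /andP[s0 sN]|s Ss /andP[s0 sN]|s Ss /andP[s0 sN]|f ff0 Hf].
- by apply: sphi => //; rewrite s0 leqW.
- by apply: bphi => //; rewrite s0 leqW.
- by apply: acyC => //; rewrite s0 leqW.
pose rhs s := phi s + eps *: lin f (face_sum s).
have /choice[g Hg] : forall s, exists b : chain W, S s -> size s = N.+1 ->
    supported (sized (Car s) (size s + r)%N) b /\ bd b = rhs s.
  move=> s; have [[Ss szs]|nS] := pselect (S s /\ size s = N.+1); last first.
    by exists 0 => Ss szs; case: nS.
  have s0 : (0 < size s <= N.+1)%N by rewrite szs leqnn.
  have Hface t : subseq t s -> (size t).+1 = size s -> S t /\ (size t <= N)%N.
    by move=> ts; rewrite szs => -[->]; split=> //; apply: clS Ss.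
  have [] := acyC s Ss _ (rhs s).
  - by [].
  - apply: supportedD; first exact: sphi.
    apply: supportedZ; apply: supported_lin (supported_face_sum s) _ => t [ts szt].
    have [St tN] := Hface t ts szt.
    have [+ _] := Hf t St tN => /sub_supported; apply=> u [Cu szu].
    by split; [apply: monC Cu|rewrite szu -szt].
  (* The boundary of [rhs s] is d phi + eps phi d plus a multiple of f d d; the last term vanishes
     and the others cancel by the hypothesis on [phi]. *)
  - rewrite linearD linearZ /= {2}/bd lin_comp.
    rewrite (eq_lin (g := fun t => phi t + eps *: lin f (face_sum t)) (supported_face_sum s)).
      rewrite linDf linZf -lin_comp -/(bd _) -(bd1 s) bd_bd raddf0 scaler0 addr0.
      by rewrite bd1 bphi.
    by move=> t [ts szt]; have [St tN] := Hface t ts szt; have [] := Hf t St tN.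
  by move=> b Sb bdb; exists b; split=> //; move: Sb; rewrite szs.
exists (fun s => if size s == N.+1 then g s else f s) => // s Ss sN.
have -> : lin (fun s => if size s == N.+1 then g s else f s) (face_sum s) =
    lin f (face_sum s).
  apply: eq_lin (supported_face_sum s) _ => t [_ szt].
  by rewrite ltn_eqF // szt.
have [szs|szs] := eqVneq (size s) N.+1; first exact: Hg.
by apply: Hf => //; rewrite -ltnS ltn_neqAle szs.
Qed.

(* The carriers [Phi] and [Psi] build chain maps from [S] to [T] and back,
   and [Theta] a homotopy from the composite to the identity. *)
Lemma carrier_transfer (V W : choiceType) (S : seq V -> Prop)
    (T T' : seq W -> Prop) (Phi : seq V -> seq W -> Prop)
    (Psi : seq W -> seq V -> Prop) (Theta : seq V -> seq V -> Prop) (k : nat) :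
  closed_under_faces S -> closed_under_faces T' ->
  (forall s t, S s -> Phi s t -> T t /\ T' t) -> monotone_carrier S Phi ->
  Phi [::] [::] ->
  (forall s, S s -> (0 < size s <= k)%N -> acyclic_at (Phi s) (size s).-1) ->
  (forall t s, T' t -> Psi t s -> S s) -> monotone_carrier T' Psi ->
  Psi [::] [::] ->
  (forall t, T' t -> (0 < size t <= k.+1)%N -> acyclic_at (Psi t) (size t).-1) ->
  (forall s u, S s -> Theta s u -> S u) -> monotone_carrier S Theta ->
  (forall s, S s -> Theta s s) ->
  (forall s t u, S s -> Phi s t -> Psi t u -> Theta s u) ->
  (forall s, S s -> (0 < size s <= k)%N -> acyclic_at (Theta s) (size s)) ->
  bounds T T' k -> acyclic_at S k.
Proof.
move=> clS clT ST monP P0 aP SS monQ Q0 aQ SH monH Hs PQ aH bT.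
have gen0 (X : choiceType) (P : seq X -> Prop) : P [::] ->
    supported (sized P 0) << [::] >> /\ bd << [::] >> = 0.
  by move=> P_; rewrite bd1; split=> //; apply: supported_gen.
have [f f0 Hf] : exists2 f, f [::] = << [::] >> & forall s, S s -> (size s <= k)%N ->
    supported (sized (Phi s) (size s + 0)%N) (f s) /\
    bd (f s) = 0 + 1 *: lin f (face_sum s).
  apply: (@carrier_extend _ _ S Phi 0 1 (fun=> 0)) => //.
  - by move=> *; apply: supported0.
  - by move=> *; rewrite raddf0 lin_cst0 scaler0 addr0.
  - by move=> s Ss sk; rewrite addn0; apply: aP.
  - by move=> _; apply: gen0.
(* [g] has to reach one degree further than [f], since it is also applied to the filling found in
   [T']. *)
have [g g0 Hg] : exists2 g, g [::] = << [::] >> & forall t, T' t -> (size t <= k.+1)%N ->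
    supported (sized (Psi t) (size t + 0)%N) (g t) /\
    bd (g t) = 0 + 1 *: lin g (face_sum t).
  apply: (@carrier_extend _ _ T' Psi 0 1 (fun=> 0)) => //.
  - by move=> *; apply: supported0.
  - by move=> *; rewrite raddf0 lin_cst0 scaler0 addr0.
  - by move=> s Ss sk; rewrite addn0; apply: aQ.
  - by move=> _; apply: gen0.
have gmap n c : (n <= k.+1)%N -> supported (sized T' n) c -> bd (lin g c) = lin g (bd c).
  move=> nk Tc; rewrite /bd !lin_comp; apply: eq_lin Tc _ => t [Tt szt].
  by rewrite -/(bd _); have [|_ ->] := Hg t Tt; rewrite ?szt // add0r scale1r.
have fmap n c : (n <= k)%N -> supported (sized S n) c -> bd (lin f c) = lin f (bd c).
  move=> nk Tc; rewrite /bd !lin_comp; apply: eq_lin Tc _ => t [Tt szt].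
  by rewrite -/(bd _); have [|_ ->] := Hf t Tt; rewrite ?szt // add0r scale1r.
pose psi s := lin g (f s) - << s >>.
have sgf s : S s -> (size s <= k)%N -> supported (sized (Theta s) (size s)) (lin g (f s)).
  move=> Ss sk; have [+ _] := Hf s Ss sk => /supported_lin; apply=> t [Pt szt].
  have [_ Tt] := ST s t Ss Pt.
  have [|+ _] := Hg t Tt; first by rewrite szt addn0 leqW.
  by move/sub_supported; apply=> u [Qu szu]; split; [apply: PQ Qu|rewrite szu szt !addn0].
have [D D0 HD] : exists2 D, D [::] = 0 & forall s, S s -> (size s <= k)%N ->
    supported (sized (Theta s) (size s + 1)%N) (D s) /\
    bd (D s) = psi s + (-1) *: lin D (face_sum s).
  apply: (@carrier_extend _ _ S Theta 1 (-1) psi) => //.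
  - move=> s Ss /andP[s0 sk]; rewrite addn1 prednK //; apply: supportedB; first exact: sgf.
    by apply: supported_gen; split=> //; apply: Hs.
  - move=> s Ss /andP[s0 sk]; have [Pf bdf] := Hf s Ss sk.
    have Tf : supported (sized T' (size s)) (f s).
      by apply: sub_supported Pf _ => t [Pt szt]; split; [have [] := ST s t Ss Pt|rewrite szt addn0].
    rewrite linearB /= (gmap (size s)) ?leqW // bdf add0r scale1r bd1 /psi linBf.
    by rewrite lin_id -lin_comp scaleN1r subrr.
  - by move=> s Ss /andP[s0 sk]; rewrite addn1 prednK //; apply: aH; rewrite ?s0.
  - move=> _; split; first exact: supported0.
    by rewrite raddf0 /psi f0 lin1 g0 subrr.
have linDbd c : supported (sized S k) c -> bd (lin D c) = lin psi c - lin D (bd c).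
  move=> Sc; rewrite /bd !lin_comp -linBf; apply: eq_lin Sc _ => s [Ss szs].
  by have [|_] := HD s Ss; rewrite ?szs // scaleN1r.
move=> c Sc bdc.
have Tfc : supported (sized T k) (lin f c).
  apply: supported_lin Sc _ => s [Ss szs].
  have [|+ _] := Hf s Ss; first by rewrite szs.
  by move/sub_supported; apply=> t [Pt szt]; split; [have [] := ST s t Ss Pt|rewrite szt szs addn0].
have [|b Tb bdb] := bT _ Tfc; first by rewrite (fmap k) // bdc raddf0.
(* The homotopy satisfies d D + D d = g f - 1. On the cycle c this reads c = g f c - d D c, where g
   f c is the boundary of g b. *)
exists (lin g b - lin D c); last first.
  rewrite linearB /= (gmap k.+1) // bdb linDbd // bdc raddf0 subr0.
  by rewrite /psi linBf lin_id -lin_comp opprB addrCA subrr addr0.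
apply: supportedB.
  apply: supported_lin Tb _ => t [Tt szt].
  have [|+ _] := Hg t Tt; first by rewrite szt.
  by move/sub_supported; apply=> s [Qs szs]; split; [apply: (SS t)|rewrite szs szt addn0].
apply: supported_lin Sc _ => s [Ss szs].
have [|+ _] := HD s Ss; first by rewrite szs.
by move/sub_supported; apply=> u [Hu szu]; split; [apply: (SH s)|rewrite szu szs addn1].
Qed.

End Carriers.

(** * Joins *)

Section Join.
Local Open Scope ring_scope.

Lemma lin_exchange (K L : choiceType) (M : lmodType int) (F : K -> L -> M)
    (c : {freeg K / int}) (e : {freeg L / int}) :
  lin (fun u => lin (F^~ u) c) e = lin (fun s => lin (F s) e) c.
Proof.
elim/freeg_ind_dom0: c => [|k s c _ _ IH].
  by rewrite raddf0 -[RHS](lin_cst0 _ e); congr lin; apply/funext => u; rewrite raddf0.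
rewrite raddfD /= lin_gen -IH -linZf -linDf.
by congr lin; apply/funext => u; rewrite raddfD /= lin_gen.
Qed.

(** The homotopy form of acyclic carriers, with the constant carrier [S], turns the fillings of
    cycles into one homotopy h with d h + h d = 1 in the acyclic range. *)
Lemma exists_contraction (V : choiceType) (S : seq V -> Prop) (m : nat) :
  closed_under_faces S -> S [::] -> (forall k, (k < m)%N -> acyclic_at S k) ->
  exists h : seq V -> chain V, [/\
    forall s, S s -> supported (sized S (size s).+1) (h s),
    forall s, (m <= size s)%N -> h s = 0 &
    forall s, S s -> (size s < m)%N -> bd (h s) + lin h (face_sum s) = << s >>].
Proof.
move=> clS S0; case: m => [|m] aS.
  exists (fun=> 0); split=> // s _; exact: supported0.
(* The empty simplex is a cycle of the augmented complex; its filling starts the homotopy. *)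
have [f0 Sf0 bdf0] : exists2 b, supported (sized S 1) b & bd b = << [::] >>.
  by apply: aS => //; [apply: supported_gen | rewrite bd1].
have [f _ Hf] : exists2 f, f [::] = f0 & forall s, S s -> (size s <= m)%N ->
    supported (sized S (size s + 1)%N) (f s) /\
    bd (f s) = << s >> + (-1) *: lin f (face_sum s).
  apply: (@carrier_extend _ _ S (fun=> S) 1 (-1) (fun s => << s >>)) => //.
  - by move=> s Ss /andP[s0 _]; rewrite addn1 prednK //; apply: supported_gen.
  - by move=> s Ss _; rewrite bd1 lin_id scaleN1r subrr.
  - by move=> s Ss /andP[s0 sm]; rewrite addn1 prednK //; apply: aS.
exists (fun s => if (size s <= m)%N then f s else 0); split.
- move=> s Ss; case: ifPn => sm; last exact: supported0.
  by have [] := Hf s Ss sm; rewrite addn1.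
- by move=> s; rewrite leqNgt ltnS => /negbTE ->.
- move=> s Ss; rewrite ltnS => sm; rewrite sm; have [_ ->] := Hf s Ss sm.
  have -> : lin (fun t => if (size t <= m)%N then f t else 0) (face_sum s) =
      lin f (face_sum s).
    by apply: eq_lin (supported_face_sum s) _ => t [_ szt]; rewrite ltnW // szt.
  by rewrite scaleN1r subrK.
Qed.

Variable V : choiceType.
Implicit Types (s t : seq V) (c d : chain V).

Definition star c d : chain V := lin (fun s => lin (fun t => << s ++ t >>) d) c.

Lemma star_lin_l (K : choiceType) (f : K -> chain V) d (e : {freeg K / int}) :
  lin (fun u => star (f u) d) e = star (lin f e) d.
Proof. by rewrite /star lin_comp. Qed.

Lemma star_lin_r (K : choiceType) c (f : K -> chain V) (e : {freeg K / int}) :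
  lin (fun u => star c (f u)) e = star c (lin f e).
Proof.
rewrite /star lin_exchange; congr lin; apply/funext => s.
by rewrite lin_comp.
Qed.

Lemma star1 s t : star << s >> << t >> = << s ++ t >>.
Proof. by rewrite /star !lin1. Qed.

Lemma star1l s d : star << s >> d = lin (fun t => << s ++ t >>) d.
Proof. by rewrite /star lin1. Qed.

Lemma star1r c t : star c << t >> = lin (fun s => << s ++ t >>) c.
Proof. by rewrite /star; congr lin; apply/funext => s; rewrite lin1. Qed.

Lemma starBl c c' d : star (c - c') d = star c d - star c' d.
Proof. exact: raddfB. Qed.

Lemma star0l d : star 0 d = 0.
Proof. exact: raddf0. Qed.

Lemma starDr c d d' : star c (d + d') = star c d + star c d'.
Proof. by rewrite /star -linDf; congr lin; apply/funext => s; rewrite raddfD. Qed.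

Lemma starBr c d d' : star c (d - d') = star c d - star c d'.
Proof. by rewrite /star -linBf; congr lin; apply/funext => s; rewrite raddfB. Qed.

Lemma star0r c : star c 0 = 0.
Proof.
by rewrite /star -[RHS](lin_cst0 _ c); congr lin; apply/funext => s; rewrite raddf0.
Qed.

Lemma face_sum_cat s t :
  face_sum (s ++ t) = star (face_sum s) << t >> +
    (-1) ^+ size s *: star << s >> (face_sum t).
Proof.
elim: s => [|v s IHs] /=.
  by rewrite star0l add0r expr0 scale1r star1l lin_id.
rewrite IHs linearD linearZ /= opprD addrA starBl star1; congr (_ - _ + _).
  by rewrite !star1r /cone !lin_comp; congr lin; apply/funext => u; rewrite !lin1.
rewrite exprS mulN1r scaleNr; congr (- (_ *: _)).
by rewrite !star1l /cone !lin_comp; congr lin; apply/funext => u; rewrite !lin1.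
Qed.

Lemma bd_star n (S : seq V -> Prop) c d : supported (sized S n) c ->
  bd (star c d) = star (bd c) d + (-1) ^+ n *: star c (bd d).
Proof.
move=> Sc; have dist s : bd (star << s >> d) =
    star (face_sum s) d + (-1) ^+ size s *: star << s >> (bd d).
  rewrite -[in LHS](lin_id d) -star_lin_r /bd lin_comp -/bd.
  rewrite -[X in star (face_sum s) X]lin_id -star_lin_r.
  rewrite -[X in _ *: X]star_lin_r -linZf -linDf; congr lin; apply/funext => t.
  by rewrite star1 -face_sum_cat; apply: bd1.
rewrite -[in LHS](lin_id c) -star_lin_l {1}/bd lin_comp.
rewrite -[in X in _ + X](lin_id c) -star_lin_l -linZf -star_lin_l -linDf.
by apply: eq_lin Sc _ => s [_ <-]; rewrite -dist.
Qed.

(** The cancellation of terms that ends the computation of d H + H d in [join_acyclic]. *)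
Lemma abelian_cancel (M : zmodType) (a b c t x y z : M) :
  t - c - a - (y + z) = 0 -> a - b + (x + y) + (c - x + (b + z)) = t.
Proof.
move/eqP; rewrite !subr_eq add0r => /eqP ->.
rewrite !addrA (ACl ((4*8*1*5)*(2*7)*(3*6)))%AC /=.
by rewrite addNr subrr !addr0.
Qed.

Lemma supported_star S1 S2 (T : seq V -> Prop) c d :
  supported S1 c -> supported S2 d ->
  (forall s t, S1 s -> S2 t -> T (s ++ t)) -> supported T (star c d).
Proof.
move=> Sc Sd ST; apply: supported_lin Sc _ => s Ss.
by apply: supported_lin Sd _ => t St; apply: supported_gen; apply: ST.
Qed.

(* Tensoring two partial contractions gives a contraction of the join in the
   range of the sum of their ranges. *)
Lemma join_acyclic (p : pred V) (S1 S2 : seq V -> Prop) m1 m2 k :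
  closed_under_faces S1 -> closed_under_faces S2 -> S1 [::] -> S2 [::] ->
  (forall s, S1 s -> all p s) -> (forall s, S2 s -> all (predC p) s) ->
  (forall k, (k < m1)%N -> acyclic_at S1 k) ->
  (forall k, (k < m2)%N -> acyclic_at S2 k) ->
  (k < m1 + m2)%N ->
  acyclic_at (fun s => exists s1 s2, [/\ s = s1 ++ s2, S1 s1 & S2 s2]) k.
Proof.
move=> cl1 cl2 S10 S20 p1 p2 a1 a2 km.
have [h1 [Sh1 h1z bdh1]] := exists_contraction cl1 S10 a1.
have [h2 [Sh2 h2z bdh2]] := exists_contraction cl2 S20 a2.
(* The defect of the first contraction. It is a chain map, and it vanishes on simplices with fewer
   than [m1] vertices. *)
pose pi1 s := << s >> - lin h1 (face_sum s) - bd (h1 s).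
have pi1z s : S1 s -> (size s < m1)%N -> pi1 s = 0.
  by move=> Ss sm; rewrite /pi1 -(bdh1 s Ss sm) addrK subrr.
have Sh1b s : S1 s -> supported (sized S1 (size s)) (lin h1 (face_sum s)).
  move=> Ss; apply: supported_lin (supported_face_sum s) _ => t [ts <-].
  by apply: Sh1; apply: cl1 Ss.
have Spi1 s : S1 s -> supported (sized S1 (size s)) (pi1 s).
  move=> Ss; apply: supportedB; last exact/supported_bd/Sh1.
  by apply: supportedB; [apply: supported_gen|apply: Sh1b].
have bdpi1 s : bd (pi1 s) = lin pi1 (face_sum s).
  rewrite /pi1 !linBf !linearB /= bd_bd subr0 bd1 lin_id -lin_comp -/(bd _).
  by rewrite -bd1 bd_bd raddf0 subr0 /bd lin_comp.
(* The homotopy h1 * 1 + pi1 * h2 up to sign; filtering by [p] recovers the two factors of a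
   simplex. Where [pi1] does not vanish, the first factor has at least [m1] vertices, so the second
   has fewer than [m2] and is contracted by [h2]. *)
pose H s := let s1 := seq.filter p s in let s2 := seq.filter (predC p) s in
  star (h1 s1) << s2 >> + (-1) ^+ size s1 *: star (pi1 s1) (h2 s2).
have HE s1 s2 : S1 s1 -> S2 s2 ->
    H (s1 ++ s2) = star (h1 s1) << s2 >> + (-1) ^+ size s1 *: star (pi1 s1) (h2 s2).
  move=> /p1 ps1 /p2 ps2; rewrite /H !filter_cat.
  have /all_filterP -> := ps1; have /all_filterP -> := ps2.
  have -> : seq.filter p s2 = [::].
    by apply/eqP; rewrite -(negbK (_ == _)) -has_filter -all_predC.
  have -> : seq.filter (predC p) s1 = [::].
    apply/eqP; rewrite -(negbK (_ == _)) -has_filter -all_predC.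
    by apply: sub_all ps1 => x /= ->.
  by rewrite cats0.
pose S s := exists s1 s2, [/\ s = s1 ++ s2, S1 s1 & S2 s2].
have key s : S s -> (size s < m1 + m2)%N -> bd (H s) + lin H (face_sum s) = << s >>.
  move=> [s1 [s2 [-> Ss1 Ss2]]]; rewrite size_cat => szs.
  have E1 : lin H (star (face_sum s1) << s2 >>) =
      star (lin h1 (face_sum s1)) << s2 >> -
      (-1) ^+ size s1 *: star (lin pi1 (face_sum s1)) (h2 s2).
    rewrite star1r lin_comp -!star_lin_l -linZf -linBf.
    apply: eq_lin (supported_face_sum s1) _ => t [ts <-].
    by rewrite lin1 HE //; [rewrite exprS mulN1r scaleNr opprK|apply: cl1 Ss1].
  have E2 : lin H (star << s1 >> (face_sum s2)) =
      star (h1 s1) (face_sum s2) +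
      (-1) ^+ size s1 *: star (pi1 s1) (lin h2 (face_sum s2)).
    rewrite star1l lin_comp -!star_lin_r -linZf -[X in star _ X]lin_id -star_lin_r.
    rewrite -linDf; apply: eq_lin (supported_face_sum s2) _ => t [ts _].
    by rewrite lin1 HE //; apply: cl2 Ss2.
  have star_pi : star (pi1 s1) (<< s2 >> - (bd (h2 s2) + lin h2 (face_sum s2))) = 0.
    have [sm1|sm1] := ltnP (size s1) m1; first by rewrite pi1z // star0l.
    rewrite bdh2 ?subrr ?star0r //.
    by rewrite -(ltn_add2l m1); apply: leq_ltn_trans szs; rewrite leq_add2r.
  rewrite HE // face_sum_cat !linearD !linearZ /= E1 E2.
  rewrite (bd_star _ (Sh1 s1 Ss1)) (bd_star _ (Spi1 s1 Ss1)) bd1 bdpi1.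
  have eps2 x : (-1) ^+ size s1 *: ((-1) ^+ size s1 *: x) = x :> chain V.
    by rewrite scalerA -expr2 sqrr_sign scale1r.
  have pi12 : star (pi1 s1) << s2 >> = << s1 ++ s2 >> -
      star (lin h1 (face_sum s1)) << s2 >> - star (bd (h1 s1)) << s2 >>.
    by rewrite -star1 /pi1 !starBl.
  rewrite exprS mulN1r scaleNr !scalerDr !eps2.
  by apply: abelian_cancel; rewrite -pi12 -starDr -starBr.
have SH s : S s -> supported (sized S (size s).+1) (H s).
  move=> [s1 [s2 [-> Ss1 Ss2]]]; rewrite HE // size_cat.
  apply: supportedD.
    apply: (supported_star (S2 := sized S2 (size s2)) (Sh1 s1 Ss1)).
      by apply: supported_gen.
    move=> u v [Su szu] [Sv szv].
    by split; [exists u, v|rewrite size_cat szu szv].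
  apply: supportedZ; apply: (supported_star (Spi1 s1 Ss1) (Sh2 s2 Ss2)).
  move=> u v [Su szu] [Sv szv].
  by split; [exists u, v|rewrite size_cat szu szv addnS].
move=> c Sc bdc; exists (lin H c).
  by apply: supported_lin Sc _ => s [Ss <-]; apply: SH.
have -> : bd (lin H c) = bd (lin H c) + lin H (bd c) by rewrite bdc raddf0 addr0.
rewrite -[RHS]lin_id /bd !lin_comp -linDf.
by apply: eq_lin Sc _ => s [Ss szs]; rewrite -/(bd _) key // szs.
Qed.
End Join.

(** * Small chains in Euclidean space *)

Section Euclidean.
Local Open Scope ring_scope.


(** * Full simplices and contiguous maps of vertices *)

Section FullSimplex.
Variable V : choiceType.

(** Repetitions are allowed, so any vertex of [l] can be put in front of any simplex: this is a
    cone, and it serves as the smallest acyclic carrier around a finite set. *)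
Definition full_simplex (l : seq V) : seq V -> Prop := fun s => {subset s <= l}.

Lemma closed_full_simplex l : closed_under_faces (full_simplex l).
Proof. by move=> s t /mem_subseq ts sl x /ts/sl. Qed.

Lemma acyclic_full_simplex l k : (0 < size l)%N -> acyclic_at (full_simplex l) k.
Proof.
case: l => // v l _; apply: (@acyclic_cone _ _ v); first exact: closed_full_simplex.
by move=> t tl x; rewrite inE => /predU1P[->|/tl //]; rewrite inE eqxx.
Qed.

End FullSimplex.

Section MapChain.
Variables V W : choiceType.

Definition map_chain (f : V -> W) : chain V -> chain W :=
  lin (fun s => << map f s >>).

Lemma face_sum_map (f : V -> W) s : face_sum (map f s) = map_chain f (face_sum s).
Proof.
elim: s => [|v s IHs] /=; first by rewrite /map_chain raddf0.
rewrite /map_chain raddfB /= lin1 IHs; congr (_ - _).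
by rewrite /cone /map_chain !lin_comp; congr lin; apply/funext => t; rewrite !lin1.
Qed.

Lemma bd_map f c : bd (map_chain f c) = map_chain f (bd c).
Proof.
rewrite /bd /map_chain !lin_comp; congr lin; apply/funext => s.
by rewrite lin1 face_sum_map.
Qed.

Lemma supported_map f (S : seq V -> Prop) (T : seq W -> Prop) k c :
  (forall s, S s -> T (map f s)) -> supported (sized S k) c ->
  supported (sized T k) (map_chain f c).
Proof.
move=> ST Sc; apply: supported_lin Sc _ => s [Ss <-].
by apply: supported_gen; split; [apply: ST|rewrite size_map].
Qed.

(** The images of a simplex under both maps span a full simplex, which carries a homotopy from one
    map to the other. *)
Lemma contiguous_maps (f g : V -> W) (S : seq V -> Prop) (T : seq W -> Prop) k c :
  closed_under_faces S ->
  (forall s u, S s -> full_simplex (map f s ++ map g s) u -> T u) ->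
  supported (sized S k) c -> bd c = 0 ->
  exists2 b, supported (sized T k.+1) b & bd b = map_chain f c - map_chain g c.
Proof.
move=> clS ST Sc bdc.
pose phi s : chain W := << map f s >> - << map g s >>.
have [D _ HD] : exists2 D, D [::] = 0 & forall s, S s -> (size s <= k)%N ->
    supported (sized (full_simplex (map f s ++ map g s)) (size s + 1)%N) (D s) /\
    bd (D s) = phi s + (-1) *: lin D (face_sum s).
  apply: (@carrier_extend _ _ S (fun s => full_simplex (map f s ++ map g s)) 1 (-1) phi) => //.
  - move=> s t u Ss ts tu x /tu; rewrite !mem_cat.
    by case/orP => /mapP[y /(mem_subseq ts) ys ->]; rewrite map_f ?orbT.
  - move=> s Ss /andP[s0 _]; rewrite addn1 prednK //.
    by apply: supportedB; apply: supported_gen; split; rewrite ?size_map // => x;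
      rewrite mem_cat => ->; rewrite ?orbT.
  - move=> s Ss _; rewrite linearB /= !bd1 !face_sum_map /phi linBf scaleN1r.
    by rewrite subrr.
  - move=> s Ss /andP[s0 _]; apply: acyclic_full_simplex.
    by rewrite size_cat size_map ltn_addr.
  - by move=> _; split; [apply: supported0|rewrite raddf0 /phi subrr].
exists (lin D c).
  apply: supported_lin Sc _ => s [Ss szs]; have [|+ _] := HD s Ss; first by rewrite szs.
  move/sub_supported; apply=> u [Du szu]; split; last by rewrite szu szs addn1.
  exact: ST Du.
have -> : bd (lin D c) = bd (lin D c) + lin D (bd c) by rewrite bdc raddf0 addr0.
rewrite /map_chain -linBf /bd !lin_comp -linDf.
apply: eq_lin Sc _ => s [Ss szs]; rewrite -/(bd _); have [|_ ->] := HD s Ss; first by rewrite szs.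
by rewrite scaleN1r subrK.
Qed.

End MapChain.

Lemma map_chain_id (V : choiceType) (f : V -> V) (S : seq V -> Prop) c :
  supported S c -> (forall s, S s -> {in s, f =1 id}) -> map_chain f c = c.
Proof.
move=> Sc fS; rewrite -[RHS]lin_id; apply: eq_lin Sc _ => s Ss.
by rewrite (eq_in_map _ id s).1 ?map_id //; apply: fS.
Qed.

Lemma map_chain_comp (U V W : choiceType) (f : V -> W) (g : U -> V) c :
  map_chain f (map_chain g c) = map_chain (f \o g) c.
Proof.
rewrite /map_chain lin_comp; congr lin; apply/funext => s.
by rewrite lin1 map_comp.
Qed.

(** * Vietoris-Rips complexes of star-shaped sets *)

Section Vietoris.
Variables (R : realType) (n : nat).
Notation E := 'rV[R]_n.
Implicit Types (A : set E) (e : R) (s : seq E).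

(** The Vietoris-Rips complex of [A] at scale [e], for the sup norm. *)
Definition small A e s : Prop :=
  (forall x, x \in s -> A x) /\ {in s &, forall x y, `|x - y| < e}.

Lemma closed_small A e : closed_under_faces (small A e).
Proof.
move=> s t /mem_subseq ts [sA se]; split=> [x /ts/sA //|x y /ts xs /ts ys].
exact: se.
Qed.

(** Finitely many strict inequalities survive a small perturbation. This lets a cycle be filled at
    its own scale, without any loss. *)
Lemma slack (l : seq (R * R)) e : {in l, forall ab, ab.1 < e} ->
  exists N : nat, {in l, forall ab, ab.1 + ab.2 / N.+1%:R < e}.
Proof.
elim: l => [|[a b] l IHl] le; first by exists 0.
have [|N HN] := IHl; first by move=> ab abl; apply: le; rewrite inE abl orbT.
have mono c d M M' : c < e -> (M <= M')%N -> c + d / M.+1%:R < e -> c + d / M'.+1%:R < e.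
  move=> ce MM'; have [d0 _|d0] := leP d 0.
    by apply: le_lt_trans ce; rewrite gerDl; apply: mulr_le0_ge0.
  by apply: le_lt_trans; rewrite lerD2l ler_pM2l // lef_pV2 ?posrE ?ltr0n // ler_nat.
have ae : a < e by apply: (le (a, b)); rewrite inE eqxx.
have [M HM] : exists M : nat, a + b / M.+1%:R < e.
  exists (Num.truncn (b / (e - a))); rewrite -ltrBrDl ltr_pdivrMr ?ltr0n //.
  by rewrite mulrC -ltr_pdivrMr ?subr_gt0 // truncnS_gt.
exists (maxn M N) => -[c d]; rewrite inE => /predU1P[[-> ->]|cdl] /=.
  by apply: mono HM => //; apply: leq_maxl.
apply: (mono _ _ N); last exact: (HN _ cdl).
  by apply: (le (c, d)); rewrite inE cdl orbT.
exact: leq_maxr.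
Qed.

(** The contraction of [A] to [x0] is cut into [N.+1] steps, so short that consecutive ones are
    contiguous at scale [e]. The last map is constant, and the image of the cycle bounds in the
    simplex on [x0]. *)
Lemma acyclic_small A e x0 k : 0 < e -> A x0 ->
  (forall x t, A x -> 0 <= t <= 1 -> A (x0 + t *: (x - x0))) ->
  acyclic_at (small A e) k.
Proof.
move=> e0 Ax0 starA c Sc bdc.
(* For each pair of vertices of a simplex: their distance, and the length of the path along which
   the second one moves. One step of the motion covers the fraction 1 / (N + 1) of that path. *)
have [|N HN] := @slack [seq (`|p.1 - p.2|, `|p.2 - x0|) |
  p <- flatten [seq [seq (x, y) | x <- s, y <- s] | s <- dom c]] e.
  move=> _ /mapP[p /flattenP[_ /mapP[s sc ->] /allpairsP[[x y] [xs ys ->]]] ->] /=.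
  by move: sc; rewrite mem_dom => /Sc [[_ +] _]; apply.
pose S s := small A e s /\ {in s &, forall x y, `|x - y| + `|y - x0| / N.+1%:R < e}.
have clS : closed_under_faces S.
  move=> s t ts [sm sl]; split; first exact: closed_small sm.
  by move=> x y /(mem_subseq ts) xs /(mem_subseq ts) ys; apply: sl.
have {}Sc : supported (sized S k) c.
  move=> s sc; have [sm szs] := Sc _ sc; split=> //; split=> // x y xs ys.
  apply: (HN (`|x - y|, `|y - x0|)).
  apply/mapP; exists (x, y) => //; apply/flattenP; exists [seq (x, y) | x <- s, y <- s].
    by apply/mapP; exists s => //; rewrite mem_dom.
  by apply/allpairsP; exists (x, y).
pose tm i : R := 1 - i%:R / N.+1%:R.
pose h i x : E := x0 + tm i *: (x - x0).
have tm01 i : (i <= N.+1)%N -> 0 <= tm i <= 1.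
  move=> iN; rewrite /tm subr_ge0 ler_pdivrMr ?ltr0n // mul1r ler_nat iN /=.
  by rewrite lerBlDr lerDl divr_ge0.
have tmS i : `|tm i - tm i.+1| = N.+1%:R^-1.
  rewrite /tm opprB addrC addrA subrK -mulrBl -natrB // subSnn mul1r.
  by rewrite ger0_norm // invr_ge0.
have dist a b x y : (a <= N.+1)%N -> `|tm a - tm b| <= N.+1%:R^-1 ->
    `|h a x - h b y| <= `|x - y| + `|y - x0| / N.+1%:R.
  move=> aN ab; have -> : h a x - h b y = tm a *: (x - y) + (tm a - tm b) *: (y - x0).
    by apply/matrixP => i j; rewrite !mxE; ring.
  apply: le_trans (ler_normD _ _) _; rewrite !normrZ; apply: lerD.
    have /andP[t0 t1] := tm01 _ aN.
    by rewrite ger0_norm // ler_piMl.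
  by rewrite mulrC ler_wpM2l.
have step i : (i <= N.+1)%N -> exists2 b, supported (sized (small A e) k.+1) b &
    bd b = map_chain (h 0%N) c - map_chain (h i) c.
  elim: i => [_|i IHi iN]; first by exists 0; [apply: supported0|rewrite raddf0 subrr].
  have [b Sb bdb] := IHi (ltnW iN).
  have [|b' Sb' bdb'] := @contiguous_maps _ _ (h i) (h i.+1) S (small A e) k c clS _ Sc bdc.
    move=> s u [[sA _] sm] us.
    have pt z : z \in u -> exists a x, [/\ (a == i) || (a == i.+1), x \in s & z = h a x].
      move/us; rewrite mem_cat => /orP[] /mapP[x xs ->].
        by exists i, x; rewrite eqxx.
      by exists i.+1, x; rewrite eqxx orbT.
    split=> [z /pt[a [x [ai xs ->]]]|z z' /pt[a [x [ai xs ->]]] /pt[a' [x' [ai' xs' ->]]]].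
      apply: starA; [exact: sA|apply: tm01].
      by case/pred2P: ai => ->; rewrite // ltnW.
    apply: le_lt_trans (sm _ _ xs xs'); apply: dist.
      by case/pred2P: ai => ->; rewrite // ltnW.
    case/pred2P: ai => ->; case/pred2P: ai' => ->; rewrite ?subrr ?normr0 ?invr_ge0 //.
      by rewrite tmS.
    by rewrite distrC tmS.
  exists (b + b'); first exact: supportedD.
  by rewrite raddfD /= bdb bdb' addrA subrK.
have [b Sb bdb] := step N.+1 (leqnn _).
have h0 : map_chain (h 0%N) c = c.
  apply: map_chain_id Sc _ => s _ x _.
  by rewrite /h /tm mul0r subr0 scale1r addrC subrK.
have hN x : h N.+1 x = x0 by rewrite /h /tm divff ?pnatr_eq0 // subrr scale0r addr0.
have [||b' Sb' bdb'] := @acyclic_full_simplex _ [:: x0] k isT (map_chain (h N.+1) c).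
- apply: supported_map Sc => s _ x /mapP[y _ ->]; rewrite hN; exact: mem_head.
- by rewrite bd_map bdc /map_chain raddf0.
exists (b + b'); last by rewrite raddfD /= bdb bdb' h0 subrK.
apply: supportedD => //; apply: sub_supported Sb' _ => s [sx0 szs]; split=> //; split.
  by move=> x /sx0; rewrite inE => /eqP ->.
by move=> x y /sx0 + /sx0; rewrite !inE => /eqP -> /eqP ->; rewrite subrr normr0.
Qed.

End Vietoris.


Definition sub_closed (V : finType) (K : {set {set V}}) : Prop :=
  forall s t : {set V}, t \subset s -> s \in K -> t \in K.

(* The sequences of vertices of a simplex may have repetitions. *)
Definition spans (V : finType) (K : {set {set V}}) : seq V -> Prop :=
  fun s => finset (mem s) \in K.

Lemma closed_spans (V : finType) (K : {set {set V}}) :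
  sub_closed K -> closed_under_faces (spans K).
Proof.
move=> clK s t /mem_subseq ts; apply: clK; apply/fintype.subsetP => x.
by rewrite !inE; apply: ts.
Qed.

(** * Complexes whose realization is a retract of a convex set *)

Section Realization.
Variables (R : realType) (V : finType).
Notation E := 'rV[R]_#|V|.

Definition bary (x : E) (v : V) : R := x ord0 (enum_rank v).

Lemma realizationP K (x : E) : realization R K x <->
  [/\ forall v, 0 <= bary x v, \sum_v bary x v = 1 &
      [set v | bary x v != 0]%SET \in K].
Proof.
have sumE : \sum_i x ord0 i = \sum_v bary x v.
  by rewrite (reindex (@enum_rank V)) //; apply: onW_bij; apply: enum_rank_bij.
rewrite /realization /= sumE; split=> -[x0 x1 xK]; split=> // i.
  exact: x0.
by rewrite -(enum_valK i); apply: x0.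
Qed.

Definition unif_continuous_on m n (A : set 'rV[R]_m) (f : 'rV[R]_m -> 'rV[R]_n) :=
  forall e, 0 < e -> exists2 d, 0 < d &
    forall x y, A x -> A y -> `|x - y| < d -> `|f x - f y| < e.

(* Choosing such a vertex for each point maps small sets of points to
   simplices. *)
Lemma exists_heavy_vertex K (x : E) : realization R K x ->
  exists v, #|V|%:R^-1 <= bary x v.
Proof.
move=> /realizationP[x0 x1 _]; apply: contrapT => nx.
have lt_x v : bary x v < #|V|%:R^-1 by rewrite ltNge; apply/negP => ?; apply: nx; exists v.
suff : \sum_v bary x v < 1 by rewrite x1 ltxx.
have V0 : (0 < #|V|)%N.
  rewrite lt0n; apply/eqP => V0; have := x1; rewrite big_pred0 => [/eqP|v].
    by rewrite eq_sym oner_eq0.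
  by have := fintype0 v V0.
have -> : 1 = \sum_(v : V) (#|V|%:R^-1 : R).
  by rewrite sumr_const -[_ *+ _]mulr_natr mulVf // pnatr_eq0 -lt0n.
by apply: ltr_sum => //; apply/hasP; have /card_gt0P[v _] := V0; exists v => //; rewrite mem_index_enum.
Qed.

Lemma bary_dist (x y : E) v : `|bary x v - bary y v| <= `|x - y|.
Proof.
rewrite [leRHS]/Num.norm /= mx_normrE; apply/bigmax_geP; right => /=.
by exists (ord0, enum_rank v) => //=; rewrite !mxE.
Qed.

Theorem retract_of_convex_acyclic (K : {set {set V}}) m (D : set 'rV[R]_m)
    (F : E -> 'rV[R]_m) (G : 'rV[R]_m -> E) y0 k :
  sub_closed K -> D y0 ->
  (forall x y t, D x -> D y -> 0 <= t <= 1 -> D (x + t *: (y - x))) ->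
  (forall x, realization R K x -> D (F x)) ->
  (forall y, D y -> realization R K (G y)) ->
  (forall x, realization R K x -> G (F x) = x) ->
  unif_continuous_on (realization R K) F -> unif_continuous_on D G ->
  acyclic_at (spans K) k.
Proof.
set A := realization R K => clK Dy0 convD FD GD GF unifF unifG.
have /exists_heavy_vertex[v0 _] := GD _ Dy0.
have K0 : finset.set0 \in K.
  by have /realizationP[_ _] := GD _ Dy0; apply: clK; apply: finset.sub0set.
have V0 : 0 < #|V|%:R^-1 :> R.
  by rewrite invr_gt0 ltr0n; apply/card_gt0P; exists v0.
have /choice[w Hw] : forall x : E, exists v, A x -> #|V|%:R^-1 <= bary x v.
  move=> x; have [/exists_heavy_vertex[v xv]|nAx] := pselect (A x); first by exists v.
  by exists v0.
(* A vertex of weight at least [e] at one point has nonzero weight at every point closer than [e].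
   The vertices chosen for an [e]-small sequence thus lie in the support of any one of its points,
   and span a simplex. *)
pose e : R := #|V|%:R^-1.
have [d2 d2_0 Gd2] := unifG e V0.
have [d d0 Fd] := unifF d2 d2_0.
pose d1 := Num.min d e.
have d1_0 : 0 < d1 by rewrite lt_min d0.
(* The closed simplex on [s]. It is star-shaped about each vertex of [s], so its small sequences
   form an acyclic carrier, which stands for iterated subdivision. *)
pose As (s : seq V) : set E := [set x | A x /\ forall v, v \notin s -> bary x v = 0]%classic.
pose vertex v : E := \row_i (i == enum_rank v)%:R.
have vertexE u v : bary (vertex u) v = (v == u)%:R.
  by rewrite /bary mxE (inj_eq enum_rank_inj).
have Avertex (s : seq V) v : spans K s -> v \in s -> As s (vertex v).
  move=> Ks vs; split; last first.
    by move=> u us; rewrite vertexE; case: eqVneq us vs => [-> /negbTE -> //|_ _ _].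
  apply/realizationP; split=> [u||]; first by rewrite vertexE ler0n.
    rewrite (bigD1 v) //= vertexE eqxx big1 ?addr0 // => u uv.
    by rewrite vertexE (negbTE uv).
  apply: clK Ks; apply/fintype.subsetP => u; rewrite !inE vertexE.
  by case: (eqVneq u v) => [-> //|_]; rewrite eqxx.
apply: (@carrier_transfer V E (spans K) (small A d1) (small A e)
  (fun s => small (As s) d1) (fun t => full_simplex (map w t)) (@full_simplex V)).
- exact: closed_spans.
- exact: closed_small.
- move=> s t Ks [tA td]; split; split=> [x /tA[]//|]; first exact: td.
  by move=> x y xt yt; apply: lt_le_trans (td x y xt yt) _; rewrite ge_min lexx orbT.
- move=> s t u Ks ts [uA ud]; split=> // x /uA[Ax xt]; split=> // v vs.
  by apply: xt; apply: contra vs; apply: mem_subseq.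
- by split.
- move=> s Ks /andP[]; case: s Ks => // v s Ks _ _.
  apply: (@acyclic_small _ _ _ _ (vertex v)) => //; first by apply: Avertex; rewrite ?mem_head.
  move=> x t [Ax xs] /andP[t0 t1].
  have [Av vs] := Avertex _ v Ks (mem_head v s).
  have baryE u : bary (vertex v + t *: (x - vertex v)) u =
      (1 - t) * bary (vertex v) u + t * bary x u.
    by rewrite /bary !mxE; ring.
  split; last by move=> u us; rewrite baryE xs // vs // !mulr0 addr0.
  have /realizationP[x0 x1 xK] := Ax; have /realizationP[v0' v1 _] := Av.
  apply/realizationP; split.
  + by move=> u; rewrite baryE addr_ge0 // mulr_ge0 // subr_ge0.
  + by under eq_bigr do rewrite baryE; rewrite big_split /= -!mulr_sumr x1 v1 !mulr1 subrK.
  + apply: clK Ks; apply/fintype.subsetP => u; rewrite !inE baryE.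
    by apply: contraNT => us; rewrite xs ?vs ?inE // !mulr0 addr0.
- move=> t s [tA te] ts; rewrite /spans.
  case: t tA te ts => [|x t] tA te ts.
    rewrite (_ : finset _ = finset.set0) //; apply/setP => v; rewrite !inE.
    by apply/negbTE/negP => /ts.
  have /realizationP[_ _ xK] := tA x (mem_head x t).
  apply: clK xK; apply/fintype.subsetP => v; rewrite !inE => /ts /mapP[y yt ->].
  have := Hw y (tA y yt); have := le_lt_trans (bary_dist y x (w y)) (te _ _ yt (mem_head x t)).
  move=> h1 h2; apply/eqP => x0; move: h1; rewrite x0 subr0 ltNge => /negP; apply.
  by apply: le_trans h2 _; apply: ler_norm.
- move=> t t' u _ tt' ut' v /ut'; exact/mem_subseq/map_subseq.
- by move=> x.
- move=> t _ /andP[t0 _]; apply: acyclic_full_simplex; by rewrite size_map.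
- move=> s u Ks us; apply: clK Ks; apply/fintype.subsetP => v; rewrite !inE; exact: us.
- by move=> s t u _ /mem_subseq ts ut v /ut/ts.
- by move=> s _ v.
- move=> s t u _ [tA _] ut v /ut /mapP[x xt ->].
  have [Ax xs] := tA x xt; apply: contraT => /xs x0.
  by have := Hw x Ax; rewrite x0 leNgt V0.
- by move=> s _ /andP[s0 _]; apply: acyclic_full_simplex.
move=> c Sc bdc.
have [|||b Sb bdb] := @acyclic_small R m D d2 y0 k d2_0 Dy0 _ (map_chain F c).
- by move=> x t Dx; apply: convD.
- apply: supported_map Sc => s [sA sd]; split=> [_ /mapP[x /sA Ax ->]|]; first exact: FD.
  move=> _ _ /mapP[x xs ->] /mapP[y ys ->]; apply: Fd; [exact: sA|exact: sA|].
  by apply: lt_le_trans (sd _ _ xs ys) _; rewrite ge_min lexx.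
- by rewrite bd_map bdc /map_chain raddf0.
exists (map_chain G b).
  apply: supported_map Sb => s [sD sd]; split=> [_ /mapP[x /sD Dx ->]|]; first exact: GD.
  by move=> _ _ /mapP[x xs ->] /mapP[y ys ->]; apply: Gd2; [apply: sD|apply: sD|apply: sd].
rewrite bd_map bdb map_chain_comp; apply: map_chain_id Sc _ => s [[sA _] _] x /sA.
exact: GF.
Qed.

End Realization.

End Euclidean.

(** * Punctured spheres *)

Section PuncturedSphere.
Local Open Scope classical_set_scope.
Local Open Scope ring_scope.


(** * Continuity and uniform continuity on subsets *)

Section EpsDelta.
Variables (R : realType) (m n : nat).
Implicit Types (A : set 'rV[R]_m) (f : 'rV[R]_m -> 'rV[R]_n).

Lemma within_continuousP A f : {within A, continuous f} <->
  forall x e, A x -> 0 < e -> exists2 d, 0 < d &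
    forall y, A y -> `|x - y| < d -> `|f x - f y| < e.
Proof.
rewrite subspace_continuousP; split=> [cf x e Ax e0|cf x Ax].
  have /cvgrPdist_lt/(_ e e0) := cf x Ax.
  rewrite near_withinE => /nbhs_ballP[d d0 xd]; exists d => // y Ay xy.
  by apply: xd => //; rewrite -ball_normE.
apply/cvgrPdist_lt => e e0; rewrite near_withinE; apply/nbhs_ballP.
by have [d d0 xd] := cf x e Ax e0; exists d => // y + Ay; rewrite -ball_normE; apply: xd.
Qed.

(** Compactness in its near-covering form, for the filter of radii tending to 0 from the right,
    yields one radius that works at all points. *)
Lemma Heine_Cantor A f : compact A -> {within A, continuous f} ->
  unif_continuous_on A f.
Proof.
move=> /compact_near_coveringP/near_covering_withinP cA /within_continuousP cf e e0.
pose P d x := forall y, A y -> `|x - y| < d -> `|f x - f y| < e.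
have [x Ax|d /= d0 Hd] := cA R (0^'+) P _; last first.
  have [r r0 Pr] : exists2 r, 0 < r & A `<=` P r.
    exists (d / 2); first by rewrite divr_gt0.
    apply: Hd; rewrite /= ?divr_gt0 // sub0r normrN gtr0_norm ?divr_gt0 //.
    by rewrite ltr_pdivrMr // ltr_pMr // ltr1n.
  by exists r => // x y Ax Ay; apply: Pr.
have [|d d0 xd] := cf x (e / 2) Ax; first by rewrite divr_gt0.
have d20 : 0 < d / 2 by rewrite divr_gt0.
exists (ball x (d / 2), [set r | r < d / 2]).
  split; first exact: nbhsx_ballx.
  by apply: nbhs_right_lt.
move=> [x' r] /= [xx' rd] Ax' y Ay x'y.
have xx'' : `|x - x'| < d / 2 by move: xx'; rewrite -ball_normE.
rewrite (splitr e); apply: le_lt_trans (ler_distD (f x) _ _) _; rewrite ltrD //.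
  rewrite distrC; apply: xd => //; apply: lt_trans xx'' _.
  by rewrite ltr_pdivrMr // ltr_pMr // ltr1n.
apply: xd => //; rewrite (splitr d); apply: le_lt_trans (ler_distD x' _ _) _.
by rewrite ltrD // (lt_trans x'y).
Qed.

End EpsDelta.

Lemma within_continuous_trans (R : realType) m n p (A : set 'rV[R]_m) (B : set 'rV[R]_n)
    (f : 'rV[R]_m -> 'rV[R]_n) (g : 'rV[R]_n -> 'rV[R]_p) :
  {within A, continuous f} -> (forall x, A x -> B (f x)) ->
  {within B, continuous g} -> {within A, continuous (g \o f)}.
Proof.
move=> /within_continuousP cf AB /within_continuousP cg; apply/within_continuousP.
move=> x e Ax e0; have [d d0 Bd] := cg (f x) e (AB x Ax) e0.
have [d' d'0 Ad] := cf x d Ax d0; exists d' => // y Ay xy.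
by apply: Bd; [apply: AB|apply: Ad].
Qed.

Lemma closed_dist (R : realType) n (A : set 'rV[R]_n) :
  (forall x, (forall e, 0 < e -> exists2 y, A y & `|x - y| < e) -> A x) -> closed A.
Proof.
move=> clA x clx; apply: clA => e e0; have [y [Ay]] := clx _ (nbhsx_ballx x e e0).
by rewrite -ball_normE => xy; exists y.
Qed.

(** * Stereographic projection *)

Section Stereographic.
Variables (R : realType) (n : nat).
Implicit Types x y z : 'rV[R]_n.

Definition dot x y : R := \sum_i x ord0 i * y ord0 i.

Lemma dotC x y : dot x y = dot y x.
Proof. by apply: eq_bigr => i _; rewrite mulrC. Qed.

Lemma dotDl x y z : dot (x + y) z = dot x z + dot y z.
Proof. by rewrite -big_split; apply: eq_bigr => i _; rewrite mxE mulrDl. Qed.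

Lemma dotZl a x y : dot (a *: x) y = a * dot x y.
Proof. by rewrite mulr_sumr; apply: eq_bigr => i _; rewrite mxE mulrA. Qed.

Lemma dotDr x y z : dot x (y + z) = dot x y + dot x z.
Proof. by rewrite dotC dotDl !(dotC x). Qed.

Lemma dotZr a x y : dot x (a *: y) = a * dot x y.
Proof. by rewrite dotC dotZl dotC. Qed.

Lemma dotNl x y : dot (- x) y = - dot x y.
Proof. by rewrite -scaleN1r dotZl mulN1r. Qed.

Lemma dotNr x y : dot x (- y) = - dot x y.
Proof. by rewrite dotC dotNl dotC. Qed.

Definition dotE := (dotDl, dotDr, dotZl, dotZr, dotNl, dotNr).

Lemma dot_ge0 x : 0 <= dot x x.
Proof. by apply: sumr_ge0 => i _; rewrite -expr2 sqr_ge0. Qed.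

Lemma dot_eq0 x : dot x x = 0 -> x = 0.
Proof.
move=> /eqP; rewrite psumr_eq0 => [/allP x0|i _]; last by rewrite -expr2 sqr_ge0.
apply/rowP => i; rewrite mxE; have := x0 i (mem_index_enum i).
by rewrite mulf_eq0 orbb => /eqP.
Qed.


Lemma dot_continuous (f g : 'rV[R]_n -> 'rV[R]_n) z :
  {for z, continuous f} -> {for z, continuous g} ->
  {for z, continuous (fun x => dot (f x) (g x))}.
Proof.
move=> cf cg; apply: (@cvg_big _ _ _ _ _ _ _ (nbhs z)) => [|i _].
  exact: add_continuous.
have fi := cvg_comp f _ cf (@coord_continuous _ _ _ ord0 i (f z)).
have gi := cvg_comp g _ cg (@coord_continuous _ _ _ ord0 i (g z)).
exact: (cvgM fi gi).
Qed.

Variable p : 'rV[R]_n.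
Hypothesis pp : dot p p = 1.

(** The point where the line through [p] and x meets the hyperplane through 0 orthogonal to [p]. *)
Definition stereo x := (1 - dot x p)^-1 *: (x - dot x p *: p).

Definition stereo_inv y := (dot y y + 1)^-1 *: (2 *: y + (dot y y - 1) *: p).

(** The equality case of Cauchy-Schwarz: if the product were 1, x - p would have square norm 1 - 2 +
    1 = 0. *)
Lemma dot_neq1 x : dot x x = 1 -> x <> p -> 1 - dot x p != 0.
Proof.
move=> xx xp; apply/eqP => h; apply: xp; apply/eqP; rewrite -subr_eq0; apply/eqP.
by apply: dot_eq0; rewrite !dotE xx pp (dotC p x); lra.
Qed.

Lemma stereo_orthogonal x : dot (stereo x) p = 0.
Proof. by rewrite /stereo !dotE pp mulr1 subrr mulr0. Qed.

Lemma stereo_inv_sphere y : dot y p = 0 -> dot (stereo_inv y) (stereo_inv y) = 1.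
Proof.
move=> yp; have y0 : dot y y + 1 != 0 by rewrite gt_eqF // ltr_wpDl // dot_ge0.
by rewrite /stereo_inv !dotE pp (dotC p y) yp; field.
Qed.

Lemma stereo_inv_neq y : dot y p = 0 -> stereo_inv y <> p.
Proof.
move=> yp /(congr1 (dot^~ p)); have y0 : dot y y + 1 != 0.
  by rewrite gt_eqF // ltr_wpDl // dot_ge0.
rewrite /stereo_inv !dotE pp yp mulr0 add0r mulr1.
by move=> /(congr1 ( *%R (dot y y + 1))); rewrite mulVKf // mulr1; lra.
Qed.

Lemma stereoK x : dot x x = 1 -> x <> p -> stereo_inv (stereo x) = x.
Proof.
move=> xx xp; have a1 := dot_neq1 xx xp; set a := dot x p in a1.
have yy : dot (stereo x) (stereo x) = (1 + a) / (1 - a).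
  by rewrite /stereo !dotE xx pp (dotC p x) -/a; field.
rewrite /stereo_inv yy /stereo -/a; apply/rowP => i; rewrite !mxE; field.
by rewrite a1 /= (_ : _ + _ = 2) ?pnatr_eq0 //; ring.
Qed.

Lemma stereo_continuous A : (forall x, A x -> dot x x = 1 /\ x <> p) ->
  {within A, continuous stereo}.
Proof.
move=> AS; apply: continuous_in_subspaceT => x /set_mem/AS[xx xp].
have cd : {for x, continuous (fun z => dot z p)}.
  apply: (@dot_continuous id (fun=> p) x).
    by move=> ? ?.
  exact: cst_continuous.
have cst (W : topologicalType) (a : W) : {for x, continuous (fun _ : 'rV[R]_n => a)}.
  exact: cst_continuous.
have cid : {for x, continuous (fun z : 'rV[R]_n => z)} by move=> ? ?.
have c1 : 1 - dot z p @[z --> x] --> 1 - dot x p by have := cvgB (cst R^o 1) cd; exact.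
have c2 : z - dot z p *: p @[z --> x] --> x - dot x p *: p.
  apply: (cvgB cid (cvgZ cd (cst _ p))).
exact: (cvgZ (cvgV (dot_neq1 xx xp) c1) c2).
Qed.

Lemma stereo_inv_continuous A : {within A, continuous stereo_inv}.
Proof.
apply: continuous_in_subspaceT => x _.
have cd : {for x, continuous (fun z => dot z z)}.
  by apply: (@dot_continuous id id x) => ? ?.
have y0 : dot x x + 1 != 0 by rewrite gt_eqF // ltr_wpDl // dot_ge0.
have cst (W : topologicalType) (a : W) : {for x, continuous (fun _ : 'rV[R]_n => a)}.
  exact: cst_continuous.
have cid : {for x, continuous (fun z : 'rV[R]_n => z)} by move=> ? ?.
have c1 : dot z z + 1 @[z --> x] --> dot x x + 1 by apply: (cvgD cd (cst R^o 1)).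
have c2 : 2 *: z + (dot z z - 1) *: p @[z --> x] --> 2 *: x + (dot x x - 1) *: p.
  apply: (cvgD (cvgZ (cst R^o 2) cid) (cvgZ (cvgB cd (cst R^o 1)) (cst _ p))).
exact: (cvgZ (cvgV y0 c1) c2).
Qed.

End Stereographic.


(** The complement of the open star of [tau]: simplices that meet [tau] without containing it are
    kept. *)
Definition deletion (V : finType) (K : {set {set V}}) (tau : {set V}) : {set {set V}} :=
  [set s in K | ~~ (tau \subset s)]%SET.

Lemma sub_closed_deletion (V : finType) (K : {set {set V}}) tau :
  sub_closed K -> sub_closed (deletion K tau).
Proof.
move=> clK s t ts; rewrite !inE => /andP[/(clK _ _ ts) -> /=]; apply: contra => taut.
exact: fintype.subset_trans ts.
Qed.

(** * Compactness of realizations, and retraction onto a deletion *)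

Section Realization.
Variables (R : realType) (V : finType).
Notation E := 'rV[R]_#|V|.
Implicit Types (K : {set {set V}}) (x : E).

Lemma bary_inj x y : bary x =1 bary y -> x = y.
Proof.
by move=> xy; apply/rowP => i; have := xy (enum_val i); rewrite /bary enum_valK.
Qed.

Lemma bary_le1 K x v : realization R K x -> bary x v <= 1.
Proof.
move=> /realizationP[x0 <- _]; rewrite (bigD1 v) //= lerDl.
exact: sumr_ge0.
Qed.

Lemma bounded_realization K : bounded_set (realization R K).
Proof.
exists 1; split=> // M M1 x Kx; rewrite /Num.norm /= mx_normrE.
apply: bigmax_le; first exact: ltW (lt_trans ltr01 M1).
move=> [i j] _ /=; rewrite (ord1 i) -(enum_valK j) -/(bary x _).
have /realizationP[x0 _ _] := Kx; rewrite ger0_norm // (le_trans _ (ltW M1)) //.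
exact: bary_le1 Kx.
Qed.

(** Supports are lower semicontinuous: a point close enough to x, compared with the least nonzero
    coordinate of x, is nonzero wherever x is. The support of a limit is thus a face of a simplex of
    [K]. *)
Lemma closed_realization K : sub_closed K -> closed (realization R K).
Proof.
move=> clK; apply: closed_dist => x Hx.
have near e v : 0 < e -> exists2 y, realization R K y & `|bary x v - bary y v| < e.
  move=> /Hx[y Ky xy]; exists y => //; apply: le_lt_trans xy.
  exact: bary_dist.
have x0 v : 0 <= bary x v.
  rewrite leNgt; apply/negP => xv.
  have [|y /realizationP[y0 _ _]] := near (- bary x v) v; first by rewrite oppr_gt0.
  rewrite ltNge => /negP; apply; rewrite distrC ger0_norm ?subr_ge0; last first.
    by apply: le_trans (y0 v); apply: ltW.
  by rewrite lerBrDr addNr.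
apply/realizationP; split=> //.
- apply/eqP; apply: contraT => /eqP x1.
  have d0 : 0 < `|\sum_v bary x v - 1| by rewrite normr_gt0 subr_eq0; apply/eqP.
  set d := `|_ - 1| in d0.
  have [y Ky xy] := Hx (d / #|V|.+1%:R) (divr_gt0 d0 (ltr0Sn _ _)).
  have /realizationP[_ y1 _] := Ky.
  suff : d < d by rewrite ltxx.
  rewrite {1}/d -y1 -sumrB; apply: le_lt_trans (ler_norm_sum _ _ _) _.
  apply: (@le_lt_trans _ _ (\sum_(v : V) d / #|V|.+1%:R)).
    by apply: ler_sum => v _; apply: le_trans (bary_dist x y v) (ltW xy).
  rewrite sumr_const -[X in X < _]mulr_natr mulrAC ltr_pdivrMr ?ltr0Sn // ltr_pM2l //.
  by rewrite ltr_nat.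
- have [e e0 He] : exists2 e : R, 0 < e & forall v, bary x v != 0 -> e <= bary x v.
    exists (\big[Num.min/1]_(v | bary x v != 0) bary x v).
      elim/big_ind: _ => // [a b a0 b0|v xv]; first by rewrite lt_min a0.
      by rewrite lt_def xv x0.
    by move=> v xv; apply: bigmin_le_cond.
  have [y /realizationP[y0 _ yK] xy] := Hx e e0.
  apply: clK yK; apply/fintype.subsetP => v; rewrite !inE => xv.
  apply/eqP => yv; have := le_lt_trans (bary_dist x y v) xy.
  by rewrite yv subr0 ltNge (le_trans (He v xv)) // ler_norm.
Qed.

Lemma compact_realization K : sub_closed K -> compact (realization R K).
Proof.
by move=> clK; apply: bounded_closed_compact;
  [apply: bounded_realization|apply: closed_realization].
Qed.

Variable tau : {set V}.
Variable v0 : V.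
Hypothesis v0tau : v0 \in tau.

(** The default value is the coordinate at [v0], which lies in [tau], so this is the true minimum
    over [tau]. *)
Definition tau_min x : R := \big[Num.min/bary x v0]_(v in tau) bary x v.

Definition tau_ind : E := \row_i (enum_val i \in tau)%:R.

(* The radial retraction away from the barycenter of [tau]. *)
Definition tau_retract x : E :=
  (1 - #|tau|%:R * tau_min x)^-1 *: (x - tau_min x *: tau_ind).

Definition tau_center : E := #|tau|%:R^-1 *: tau_ind.

Lemma bary_ind v : bary tau_ind v = (v \in tau)%:R.
Proof. by rewrite /bary mxE enum_rankK. Qed.

Lemma bary_retract x v : bary (tau_retract x) v =
  (1 - #|tau|%:R * tau_min x)^-1 * (bary x v - tau_min x * (v \in tau)%:R).
Proof. by rewrite -bary_ind /bary !mxE. Qed.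

Lemma bary_center v : bary tau_center v = #|tau|%:R^-1 * (v \in tau)%:R.
Proof. by rewrite -bary_ind /bary !mxE. Qed.

Lemma tau_min_le x v : v \in tau -> tau_min x <= bary x v.
Proof. by move=> vtau; apply: bigmin_le_cond. Qed.

Lemma tau_min_attained x : exists2 v, v \in tau & tau_min x = bary x v.
Proof.
rewrite /tau_min; elim/big_ind: _ => [|a b [v vtau ->] [w wtau ->]|v vtau].
- by exists v0.
- by rewrite /Num.min; case: ifP => _; [exists v|exists w].
- by exists v.
Qed.

Lemma tau_card : #|tau|%:R != 0 :> R.
Proof. by rewrite pnatr_eq0 -lt0n; apply/card_gt0P; exists v0. Qed.

Lemma sum_ind (a : R) : \sum_v a * (v \in tau)%:R = #|tau|%:R * a.
Proof.
rewrite -mulr_sumr mulrC; congr (_ * _).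
rewrite (bigID (fun v => v \in tau)) /= [X in _ + X]big1 ?addr0.
  by rewrite (eq_bigr (fun=> 1)) ?sumr_const // => v ->.
by move=> v /negbTE ->.
Qed.

Lemma tau_center_realization K : sub_closed K -> tau \in K -> realization R K tau_center.
Proof.
move=> clK tauK; apply/realizationP; split.
- by move=> v; rewrite bary_center mulr_ge0 ?invr_ge0 ?ler0n.
- under eq_bigr do rewrite bary_center.
  by rewrite sum_ind mulfV // tau_card.
- apply: clK tauK; apply/fintype.subsetP => v; rewrite !inE bary_center.
  by case: (v \in tau); rewrite ?mulr0 ?eqxx.
Qed.

(** This number is the mass left after subtracting the minimum from every coordinate in [tau]. If no
    mass is left, x is constant on [tau] and zero elsewhere, hence is the barycenter. *)
Lemma tau_retract_neq0 K x : realization R K x -> x <> tau_center ->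
  0 < 1 - #|tau|%:R * tau_min x.
Proof.
move=> /realizationP[x0 x1 _] xc.
have le v : 0 <= bary x v - tau_min x * (v \in tau)%:R.
  by case: (boolP (v \in tau)) => vtau; rewrite ?mulr1 ?mulr0 ?subr0 // subr_ge0 tau_min_le.
have sumE : 1 - #|tau|%:R * tau_min x = \sum_v (bary x v - tau_min x * (v \in tau)%:R).
  by rewrite sumrB x1 sum_ind.
rewrite lt_neqAle sumE sumr_ge0 ?andbT // eq_sym; apply/negP => sum0.
have x_ind v : bary x v = tau_min x * (v \in tau)%:R.
  move: sum0; rewrite psumr_eq0 // => /allP/(_ v (mem_index_enum v)).
  by rewrite subr_eq0 => /eqP.
apply: xc; apply: bary_inj => v; rewrite bary_center x_ind; congr (_ * _).
apply: (mulfI tau_card); rewrite mulfV ?tau_card // -sum_ind -[RHS]x1.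
by apply: eq_bigr => u _; rewrite [RHS]x_ind.
Qed.

Lemma tau_retract_realization K x : sub_closed K -> realization R K x ->
  x <> tau_center -> realization R (deletion K tau) (tau_retract x).
Proof.
move=> clK Kx xc; have c0 := tau_retract_neq0 Kx xc.
have /realizationP[x0 x1 xK] := Kx; apply/realizationP; split.
- move=> v; rewrite bary_retract mulr_ge0 ?invr_ge0 ?(ltW c0) //.
  by case: (boolP (v \in tau)) => vtau; rewrite ?mulr1 ?mulr0 ?subr0 // subr_ge0 tau_min_le.
- under eq_bigr do rewrite bary_retract.
  by rewrite -mulr_sumr sumrB x1 sum_ind mulVf // gt_eqF.
- rewrite inE; apply/andP; split.
    apply: clK xK; apply/fintype.subsetP => v; rewrite !inE bary_retract.
    apply: contra => /eqP xv; rewrite xv.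
    case: (boolP (v \in tau)) => vtau; last by rewrite mulr0 subrr mulr0.
    have := tau_min_le x vtau; have [u _ ->] := tau_min_attained x.
    rewrite xv => u0; have -> : bary x u = 0 by apply/eqP; rewrite eq_le u0 x0.
    by rewrite mul0r subrr mulr0.
  have [v vtau xv] := tau_min_attained x; apply/negP => /fintype.subsetP/(_ v vtau).
  by rewrite inE bary_retract -xv vtau mulr1 subrr mulr0 eqxx.
Qed.

Lemma tau_retract_id K x : realization R (deletion K tau) x -> tau_retract x = x.
Proof.
move=> /realizationP[x0 _]; rewrite inE => /andP[_ /fintype.subsetPn[v vtau]].
rewrite inE negbK => /eqP xv.
have m0 : tau_min x = 0.
  apply/eqP; rewrite eq_le; have := tau_min_le x vtau; rewrite xv => ->.
  by rewrite /=; have [u _ ->] := tau_min_attained x; apply: x0.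
by rewrite /tau_retract m0 mulr0 subr0 invr1 scale1r scale0r subr0.
Qed.

Lemma tau_retract_continuous (A : set E) K :
  (forall x, A x -> realization R K x /\ x <> tau_center) ->
  {within A, continuous tau_retract}.
Proof.
move=> AK; apply: continuous_in_subspaceT => x /set_mem/AK[Kx xc].
have cm : {for x, continuous tau_min}.
  have cb v : {for x, continuous (fun z : E => (bary z v : R^o))}.
    exact: coord_continuous.
  pose minr r (z : E) : R^o := \big[Num.min/bary z v0]_(v <- r | v \in tau) bary z v.
  suff : forall r, {for x, continuous (minr r)} by apply.
  elim=> [|v r IHr].
    have -> : minr [::] = fun z : E => bary z v0 by apply/funext => z; rewrite /minr big_nil.
    exact: cb.
  pose f z : R^o := bary z v.
  have -> : minr (v :: r) = if v \in tau then (f \min minr r)%R else minr r.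
    by apply/funext => z; rewrite /minr big_cons; case: ifP.
  by case: ifP => // _; apply: continuous_min => //; apply: cb.
have cst (W : topologicalType) (a : W) : {for x, continuous (fun _ : E => a)}.
  exact: cst_continuous.
have cid : {for x, continuous (fun z : E => z)} by move=> ? ?.
have c1 : 1 - #|tau|%:R * tau_min z @[z --> x] --> 1 - #|tau|%:R * tau_min x.
  by have := cvgB (cst R^o 1) (cvgM (cst R^o #|tau|%:R) cm); exact.
have c2 : z - tau_min z *: tau_ind @[z --> x] --> x - tau_min x *: tau_ind.
  apply: (cvgB cid (cvgZ cm (cst _ tau_ind))).
have c0 : 1 - #|tau|%:R * tau_min x != 0 by rewrite gt_eqF // (tau_retract_neq0 Kx).
exact: (cvgZ (cvgV c0 c1) c2).
Qed.

(** The homeomorphism sends the barycenter of [tau] to [p], and the deletion into the sphere minus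
    [p], hence into the hyperplane. Points of the hyperplane may come back outside the deletion, but
    never at the barycenter, so the radial retraction applies to them. *)
Theorem deletion_acyclic K n k : sub_closed K -> tau \in K ->
  homeomorphic (realization R K) (@unit_sphere R n) ->
  acyclic_at (spans (deletion K tau)) k.
Proof.
move=> clK tauK [f [g [cf cg fK gK]]].
have clD := sub_closed_deletion (tau := tau) clK.
have cK := tau_center_realization clK tauK.
pose p := f tau_center.
have pp : dot p p = 1 by have [] := fK _ cK.
have DK x : realization R (deletion K tau) x -> realization R K x /\ x <> tau_center.
  move=> Dx; have /realizationP[x0 x1] := Dx; rewrite inE => /andP[xK ntau].
  split; first exact/realizationP.
  move=> xc; move/negP: ntau; apply; apply/fintype.subsetP => v vtau.
  by rewrite inE xc bary_center vtau mulr1 invr_eq0 tau_card.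
have fp x : realization R (deletion K tau) x -> dot (f x) (f x) = 1 /\ f x <> p.
  move=> /DK[Kx xc]; have [ff gf] := fK _ Kx; split=> // fxp.
  by apply: xc; rewrite -gf fxp /p; have [_ ->] := fK _ cK.
pose F := stereo p \o f.
have cF : {within realization R (deletion K tau), continuous F}.
  apply: (@within_continuous_trans _ _ _ _ _ [set x | dot x x = 1 /\ x <> p]).
  - by apply: continuous_subspaceW cf => x /DK[].
  - exact: fp.
  - exact: stereo_continuous.
have cptD := compact_realization clD.
have /compact_bounded[r0 [_ Hr0]] := continuous_compact cF cptD.
pose r := Num.max 0 (r0 + 1).
have Fr x : realization R (deletion K tau) x -> `|F x| <= r.
  move=> Dx; apply: le_trans (Hr0 (r0 + 1) _ _ _) _; first by rewrite ltrDl.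
    by exists x.
  by rewrite le_max lexx orbT.
(* A ball of the hyperplane, large enough to contain the image of the deletion and the origin. Its
   compactness makes [G] uniformly continuous. *)
pose D := [set y : 'rV[R]_n | dot y p = 0 /\ `|y| <= r].
pose G := tau_retract \o (g \o stereo_inv p).
have inv_sphere y : D y -> unit_sphere (stereo_inv p y).
  by case=> yp _; have := stereo_inv_sphere pp yp.
have ginv y : D y -> realization R K (g (stereo_inv p y)) /\ g (stereo_inv p y) <> tau_center.
  move=> Dy; have [Kg fg] := gK _ (inv_sphere _ Dy); split=> // gc.
  by case: Dy => yp _; apply: (stereo_inv_neq pp yp); rewrite -fg gc.
have cptDr : compact D.
  apply: bounded_closed_compact.
    by exists r; split=> [|M rM y [_ yr]]; [exact: num_real|apply: le_trans yr (ltW rM)].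
  apply: closed_dist => y Hy; split.
    apply/eqP; apply: contraT; rewrite -normr_gt0; set d := `|dot y p| => d0.
    pose C := \sum_i `|p ord0 i| + 1.
    have C0 : 0 < C by rewrite ltr_wpDl // sumr_ge0.
    have [z [zp _] yz] := Hy (d / C) (divr_gt0 d0 C0).
    suff : d < d by rewrite ltxx.
    have dE : d = `|dot (y - z) p| by rewrite !dotE zp subr0.
    rewrite {1}dE.
    apply: le_lt_trans (ler_norm_sum _ _ _) _.
    apply: (@le_lt_trans _ _ (`|y - z| * \sum_i `|p ord0 i|)).
      rewrite mulr_sumr; apply: ler_sum => i _; rewrite normrM ler_wpM2r //.
      rewrite [leRHS]/Num.norm /= mx_normrE; apply/bigmax_geP; right => /=.
      by exists (ord0, i).
    apply: (@le_lt_trans _ _ (`|y - z| * C)); first by rewrite ler_wpM2l // lerDl.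
    by rewrite -ltr_pdivlMr //.
  apply/ler_addgt0Pr => e e0; have [z [_ zr] yz] := Hy e e0.
  rewrite -(subrK z y); apply: le_trans (ler_normD _ _) _.
  by rewrite addrC lerD // ltW.
apply: (@retract_of_convex_acyclic R V _ n D F G 0) => //.
- by split; [rewrite /dot big1 // => i _; rewrite mxE mul0r|rewrite normr0 le_max lexx].
- move=> x y t [xp xr] [yp yr] /andP[t0 t1]; split.
    by rewrite !dotE xp yp subr0 mulr0 addr0.
  have -> : x + t *: (y - x) = (1 - t) *: x + t *: y.
    by apply/rowP => i; rewrite !mxE; ring.
  apply: le_trans (ler_normD _ _) _; rewrite !normrZ !ger0_norm ?subr_ge0 //.
  have -> : r = (1 - t) * r + t * r by ring.
  by apply: lerD; apply: ler_wpM2l; rewrite ?subr_ge0.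
- by move=> x Dx; split; [apply: stereo_orthogonal|apply: Fr].
- by move=> y /ginv[Kg gc]; apply: tau_retract_realization.
- move=> x Dx; have [Kx xc] := DK _ Dx; have [xx xp] := fp _ Dx.
  rewrite /G /F /= stereoK //; have [_ ->] := fK _ Kx.
  exact: tau_retract_id Dx.
- exact: Heine_Cantor.
- apply: Heine_Cantor => //.
  apply: (@within_continuous_trans _ _ _ _ _ [set x | realization R K x /\ x <> tau_center]).
  + apply: (@within_continuous_trans _ _ _ _ _ (@unit_sphere R n)) => //.
    exact: stereo_inv_continuous.
  + exact: ginv.
  + by apply: (@tau_retract_continuous _ K).
Qed.

End Realization.

End PuncturedSphere.

(** * Oriented chains *)

Section OrientedChains.
Local Open Scope ring_scope.


(** * Strictly increasing sequences *)

Section StrictSequences.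
Variables (V : choiceType) (r : rel V).
Hypotheses (r_trans : transitive r) (r_irr : irreflexive r).

Definition strict_seqs (A : V -> Prop) : seq V -> Prop :=
  fun s => (forall x, x \in s -> A x) /\ sorted r s.

Lemma closed_strict_seqs A : closed_under_faces (strict_seqs A).
Proof.
move=> s t ts [sA ss]; split=> [x /(mem_subseq ts)/sA //|].
exact: subseq_sorted ss.
Qed.

(** A least element can only occur at the head of an increasing sequence, so it is the apex of a
    strict cone. *)
Lemma acyclic_strict_seqs A m k : A m -> (forall x, A x -> x = m \/ r m x) ->
  acyclic_at (strict_seqs A) k.
Proof.
move=> Am minm; apply: (@acyclic_strict_cone _ _ m); first exact: closed_strict_seqs.
  move=> t [tA ts] mt; split; first by move=> x; rewrite inE => /predU1P[->|/tA].
  rewrite /= path_sortedE // ts andbT; apply/allP => x xt.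
  by have [xm|//] := minm x (tA x xt); rewrite -xm xt in mt.
move=> [//|x t] [tA ts] mt.
have xm : x = m.
  have [//|mx] := minm x (tA x (mem_head x t)).
  move: mt; rewrite inE => /predU1P[->//|mt].
  move: ts; rewrite /= path_sortedE // => /andP[/allP/(_ m mt) xm _].
  by have := r_irr x; rewrite (r_trans xm mx).
exists t; first by rewrite xm.
apply/negP => /= mt'; move: ts; rewrite /= path_sortedE // => /andP[/allP/(_ m mt')].
by rewrite xm r_irr.
Qed.

End StrictSequences.

(** * Comparison with the chains used in the definition of homology *)

Section Oriented.
Variable V : finType.
Implicit Types (K : {set {set V}}) (s t : seq V) (A : {set V}).

Definition rank_lt (u v : V) := (enum_rank u < enum_rank v)%N.

Lemma rank_lt_trans : transitive rank_lt.
Proof. by move=> v u w; apply: ltn_trans. Qed.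

Lemma rank_lt_irr : irreflexive rank_lt.
Proof. by move=> v; apply: ltnn. Qed.

Lemma rank_lt_total u v : u = v \/ rank_lt u v \/ rank_lt v u.
Proof.
rewrite /rank_lt; case: ltngtP => [||uv]; auto.
by left; apply: enum_rank_inj; apply: val_inj.
Qed.

(** One generator for each simplex, with its vertices in the order that fixes the signs of
    [boundary]. *)
Definition oriented_seqs K : seq V -> Prop :=
  fun s => sorted rank_lt s /\ spans K s.

Lemma eq_strict_seq s t : sorted rank_lt s -> sorted rank_lt t -> s =i t -> s = t.
Proof. exact: (irr_sorted_eq rank_lt_trans rank_lt_irr). Qed.

Definition seq_of A : seq V :=
  sort (relpre (@enum_rank V) (fun i j => i <= j)%N) (enum A).

Lemma mem_seq_of A : seq_of A =i A.
Proof. by move=> v; rewrite mem_sort mem_enum. Qed.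

Lemma size_seq_of A : size (seq_of A) = #|A|.
Proof. by rewrite size_sort -cardE. Qed.

Lemma sorted_seq_of A : sorted rank_lt (seq_of A).
Proof.
have : sorted ltn (map (fun v => enum_rank v : nat) (seq_of A)).
  rewrite ltn_sorted_uniq_leq map_inj_uniq; last first.
    by move=> u v /val_inj/enum_rank_inj.
  rewrite sort_uniq enum_uniq sorted_map /=.
  by apply: sort_sorted => u v; apply: leq_total.
by rewrite sorted_map.
Qed.

Definition set_of_seq s : {set V} := [set x in s]%SET.

Lemma seq_ofK A : set_of_seq (seq_of A) = A.
Proof. by apply/setP => v; rewrite inE mem_seq_of. Qed.

Lemma set_of_seqK s : sorted rank_lt s -> seq_of (set_of_seq s) = s.
Proof.
move=> ss; apply: eq_strict_seq => //; first exact: sorted_seq_of.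
by move=> v; rewrite mem_seq_of inE.
Qed.

Lemma eq_set_of_seq s t : sorted rank_lt s -> sorted rank_lt t ->
  (set_of_seq s == set_of_seq t) = (s == t).
Proof.
move=> ss st; apply/eqP/eqP => [|-> //].
by rewrite -{2}(set_of_seqK ss) -{2}(set_of_seqK st) => ->.
Qed.

Lemma coeff_cone v (c : chain V) w u :
  coeff (w :: u) (cone v c) = (v == w)%:R * coeff u c.
Proof.
elim/freeg_ind_dom0: c => [|k s c _ _ IH]; first by rewrite raddf0 !coeff0 mulr0.
rewrite raddfD /= !coeffD IH freeg_scale linearZ /= cone1 !coeffZ !coeffU mulrDr.
by congr (_ + _); rewrite eqseq_cons !mul1r mulrCA -natrM mulnb.
Qed.

Lemma coeff_cone_nil v (c : chain V) : coeff [::] (cone v c) = 0.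
Proof.
elim/freeg_ind_dom0: c => [|k s c _ _ IH]; first by rewrite raddf0 !coeff0.
by rewrite raddfD /= coeffD IH freeg_scale linearZ /= cone1 coeffZ coeffU addr0 !mulr0.
Qed.

(** The recursive signs agree with the incidence numbers of [boundary]. A head common to [u] and [s]
    contributes -1 through the recursion on one side, and precedes the omitted vertex, adding one to
    the count, on the other. *)
Lemma coeff_face_sum u s : sorted rank_lt u -> sorted rank_lt s ->
  coeff u (face_sum s) = \sum_(v | v \notin u)
    (-1) ^+ count (rank_lt^~ v) u * (v |: set_of_seq u == set_of_seq s)%SET%:R.
Proof.
elim: s u => [|v s IHs] u su.
  move=> _; rewrite /= coeff0 big1 // => v _; case: eqP => [|_]; last by rewrite mulr0.
  by move=> /setP/(_ v); rewrite !inE eqxx.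
rewrite /= path_sortedE; last exact: rank_lt_trans.
move=> /andP[/allP vs ss]; have vns : v \notin s.
  by apply/negP => /vs; rewrite rank_lt_irr.
rewrite coeffB coeffU mul1r.
have [vu|vu] := boolP (v \in u); last first.
  rewrite (bigD1 v) //= [X in _ = _ + X]big1 => [|w /andP[wu wv]]; last first.
    case: eqP => [/setP/(_ v)|_]; last by rewrite mulr0.
    by rewrite !inE eqxx (negbTE vu) eq_sym (negbTE wv).
  have -> : coeff u (cone v (face_sum s)) = 0.
    case: u vu {su} => [_|w u]; first exact: coeff_cone_nil.
    by rewrite inE negb_or coeff_cone => /andP[/negbTE -> _]; rewrite mul0r.
  rewrite addr0 subr0.
  have -> : (v |: set_of_seq u == set_of_seq (v :: s))%SET = (set_of_seq s == set_of_seq u).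
    rewrite eq_sym; apply/eqP/eqP => [/setP us|<-]; last by apply/setP => x; rewrite !inE.
    apply/setP => x; have := us x; rewrite !inE; case: eqVneq => [->|_ //] _.
    by rewrite (negbTE vu) (negbTE vns).
  rewrite eq_set_of_seq //; case: eqP => [<-|_]; last by rewrite mulr0.
  rewrite (eq_in_count (a2 := pred0)) ?count_pred0 ?expr0 ?mul1r // => x /vs /=.
  by move=> vx; apply/negbTE/negP => xv; have := rank_lt_irr v; rewrite (rank_lt_trans vx xv).
have -> : (s == u) = false.
  by apply/negbTE; apply: contra vns => /eqP ->.
rewrite sub0r; case: u su vu => // w u; rewrite coeff_cone /= path_sortedE; last exact: rank_lt_trans.
move=> /andP[/allP wu su]; rewrite inE => vu.
have [vw|vw] := eqVneq v w; last first.
  rewrite mul0r oppr0 big1 // => x _; case: eqP => [/setP/(_ w)|_]; last by rewrite mulr0.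
  rewrite !inE eqxx orbT eq_sym (negbTE vw) /= => /esym/vs vw'.
  have /wu wv : v \in u by move: vu; rewrite (negbTE vw).
  by have := rank_lt_irr v; rewrite (rank_lt_trans vw' wv).
subst w; have vnu : v \notin u by apply/negP => /wu; rewrite rank_lt_irr.
rewrite mul1r IHs // -sumrN [LHS](bigD1 v) //= [X in X + _](_ : _ = 0) ?add0r.
  rewrite [in LHS](eq_bigl (fun x => x \notin v :: u)); last first.
    by move=> x; rewrite inE negb_or andbC.
  apply: eq_bigr => x; rewrite inE negb_or => /andP[xv xu].
  have -> : (x |: set_of_seq (v :: u) == set_of_seq (v :: s))%SET =
      (x |: set_of_seq u == set_of_seq s)%SET.
    apply/eqP/eqP => /setP E; apply/setP => y; have := E y; rewrite !inE; last first.
      by rewrite orbCA => ->.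
    case: (eqVneq y v) => [->|_] //= _.
    by rewrite (negbTE vnu) (negbTE vns) orbF eq_sym (negbTE xv).
  case: eqP => [/setP xus|_]; last by rewrite !mulr0 oppr0.
  have xs : x \in s by have := xus x; rewrite !inE eqxx.
  by rewrite (vs _ xs) add1n exprS mulN1r mulNr.
case: eqP => [/setP/(_ v)|_]; last by rewrite mulr0 oppr0.
by rewrite !inE eqxx (negbTE vns).
Qed.

Lemma supported_oriented_eq0 K c : supported (oriented_seqs K) c ->
  (forall A, coeff (seq_of A) c = 0) -> c = 0.
Proof.
move=> Kc c0; apply/eqP/freeg_eqP => s; rewrite coeff0; apply/eqP.
apply: contraT => sc; have [ss _] := Kc _ sc.
by rewrite -(set_of_seqK ss) c0 eqxx in sc.
Qed.

Definition ffun_of (c : chain V) : {ffun {set V} -> int} :=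
  [ffun A => coeff (seq_of A) c].

Lemma boundary_ffun_of K c : supported (oriented_seqs K) c ->
  boundary (ffun_of c) = ffun_of (bd c).
Proof.
move=> Kc; apply/ffunP => A; rewrite !ffunE.
move: c Kc; apply: supported_ind.
  rewrite raddf0 coeff0 big1 // => v _; by rewrite ffunE coeff0 mulr0.
move=> k s c [ss _] IH; rewrite raddfD /= coeffD -IH.
rewrite freeg_scale linearZ /= bd1 coeffZ coeff_face_sum //; last exact: sorted_seq_of.
have inA v : (v \notin seq_of A) = (v \notin A) by rewrite mem_seq_of.
rewrite mulr_sumr (eq_bigl _ _ inA) -big_split; apply: eq_bigr => v vA /=.
rewrite !ffunE coeffD mulrDr; congr (_ + _).
rewrite coeffZ coeffU mul1r mulrCA seq_ofK; congr (k * (_ * _)); last first.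
  rewrite eq_sym -eq_set_of_seq ?seq_ofK //; exact: sorted_seq_of.
congr (_ ^+ _); rewrite -size_filter -(card_uniqP _); last first.
  by rewrite filter_uniq // sort_uniq enum_uniq.
by apply: eq_card => x; rewrite inE mem_filter mem_seq_of andbC.
Qed.

Lemma acyclic_reduced_homology K k : sub_closed K ->
  acyclic_at (oriented_seqs K) k -> reduced_homology_vanishes K (k%:Z - 1).
Proof.
move=> clK aK c Kc bdc.
pose c' : chain V := \sum_A c A *: << seq_of A >>.
have c'E A : coeff (seq_of A) c' = c A.
  rewrite /c' raddf_sum /= (bigD1 A) //= coeffZ coeffU eqxx !mulr1 big1 ?addr0 //.
  move=> A' A'A; rewrite coeffZ coeffU; case: eqP => [E|_]; last by rewrite !mulr0.
  by move: A'A; rewrite -(seq_ofK A') E seq_ofK eqxx.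
have Sc' : supported (sized (oriented_seqs K) k) c'.
  rewrite /c'; elim/big_ind: _ => [|x y|A _]; first exact: supported0.
    exact: supportedD.
  have [->|cA] := eqVneq (c A) 0; first by rewrite scale0r; apply: supported0.
  have [AK Ak] := Kc A cA; apply: supportedZ; apply: supported_gen; split.
    by split; [apply: sorted_seq_of|rewrite /spans -/(set_of_seq _) seq_ofK].
  by rewrite size_seq_of; apply/eqP; rewrite -eqz_nat Ak subrK.
have ffc' : ffun_of c' = c by apply/ffunP => A; rewrite ffunE c'E.
have Kc' : supported (oriented_seqs K) c' by apply: sub_supported Sc' _ => s [].
have clO : closed_under_faces (oriented_seqs K).
  move=> s t ts [ss Ks]; split; last exact: closed_spans Ks.
  exact: (subseq_sorted rank_lt_trans) ss.
have bdc' : bd c' = 0.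
  apply: (@supported_oriented_eq0 K).
    apply: supported_lin Kc' _ => s Ss; apply: sub_supported (supported_face_sum s) _.
    by move=> t [ts _]; apply: clO Ss.
  move=> A; have := boundary_ffun_of Kc'; rewrite ffc' bdc => /ffunP/(_ A).
  by rewrite !ffunE.
have [b Sb bdb] := aK c' Sc' bdc'.
have Kb : supported (oriented_seqs K) b by apply: sub_supported Sb _ => s [].
exists (ffun_of b); last by rewrite (boundary_ffun_of Kb) bdb ffc'.
move=> A; rewrite ffunE => /Sb[[_ +] szA]; rewrite /spans -/(set_of_seq _) seq_ofK.
by split=> //; rewrite -size_seq_of szA subrK -addn1 PoszD.
Qed.

End Oriented.

End OrientedChains.

(** * Order complexes *)

Section OrderComplexes.
Local Open Scope order_scope.


(** * Spheres without some pairwise non-adjacent vertices *)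

Section Sphere.
Variables (R : realType) (V : finType) (K : {set {set V}}) (n : nat).
Hypotheses (clK : sub_closed K)
  (sphereK : homeomorphic (realization R K) (@unit_sphere R n)).
Variable tau : {set V}.
Hypothesis tauK : tau \in K.

(* A chain of low degree cannot meet the open star of [tau], whose complement
   is acyclic. *)
Lemma acyclic_sphere k : (k < #|tau|)%N -> acyclic_at (spans K) k.
Proof.
move=> ktau c Sc bdc.
have [v vtau] : exists v, v \in tau by apply/card_gt0P; apply: leq_ltn_trans ktau.
have [|b Sb bdb] := deletion_acyclic (k := k) vtau clK tauK sphereK _ bdc.
  apply: sub_supported Sc _ => s [Ks szs]; split=> //; rewrite /spans inE; apply/andP; split=> //.
  apply/negP => /subset_leq_card; rewrite leqNgt => /negP; apply.
  by apply: leq_ltn_trans ktau; rewrite -szs cardsE; apply: card_size.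
exists b => //; apply: sub_supported Sb _ => s [+ szs]; rewrite /spans inE => /andP[Ks _].
by split.
Qed.

Definition avoid (l : seq V) : {set {set V}} :=
  [set s in K | all (fun v => v \notin s) l]%SET.

(** The vertices of [l] are deleted one at a time. A simplex has at most one of them, so the
    deletion of [v] and the complex avoiding the others cover [K]. Mayer-Vietoris thus always
    consults the full sphere, one degree up: hence [k.+1], whatever the length of [l]. *)
Lemma acyclic_avoid (l : seq V) k : {in l, forall v, [set v]%SET \in K} ->
  uniq l ->
  (forall s, s \in K -> {in l &, forall u v, u \in s -> v \in s -> u = v}) ->
  (k.+1 < #|tau|)%N -> acyclic_at (spans (avoid l)) k.
Proof.
move=> + + + ktau; elim: l => [_ _ _|v l IHl lK /=/andP[vl ul] disj].
  have -> : avoid [::] = K by apply/setP => s; rewrite inE andbT.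
  by apply: acyclic_sphere; apply: ltnW.
have -> : spans (avoid (v :: l)) =
    (fun s => spans (deletion K [set v]%SET) s /\ spans (avoid l) s).
  apply/funext => s; apply/propext; rewrite /spans !inE /= finset.sub1set inE.
  case: (_ \in K) => /=; last by split=> [|[]].
  by split=> [/andP[]|[-> ->]].
apply: Mayer_Vietoris.
- by apply: closed_spans; apply: sub_closed_deletion.
- apply: closed_spans => s t ts; rewrite !inE => /andP[Ks /allP ls].
  rewrite (clK ts Ks); apply/allP => u ul'; apply: contra (ls u ul').
  exact: (fintype.subsetP ts).
- apply: (deletion_acyclic _ clK _ sphereK) => //; first exact: (set11 v).
  by apply: lK; rewrite mem_head.
- apply: IHl => // [u ul'|s Ks u w ul' wl]; first by apply: lK; rewrite inE ul' orbT.
  by apply: disj => //; rewrite inE ?ul' ?wl orbT.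
- have -> : (fun s => spans (deletion K [set v]%SET) s \/ spans (avoid l) s) = spans K.
    apply/funext => s; apply/propext; rewrite /spans !inE finset.sub1set.
    split=> [[]/andP[]//|Ks]; rewrite Ks /=.
    have [vs|vs] := boolP (v \in finset (mem s)); last by left.
    right; apply/allP => u ul'; apply/negP => us; move: vl; rewrite -(disj _ Ks u v) ?ul' //.
      by rewrite inE ul' orbT.
    exact: mem_head.
  exact: acyclic_sphere.
Qed.

End Sphere.

(** * Chains of a poset and its order complex *)

Section Poset.
Variables (d : Order.disp_t) (T : finPOrderType d).
Implicit Types (P : {set T}) (s t : seq T).

Lemma sub_closed_order_complex P : sub_closed (order_complex P).
Proof.
move=> s t ts; rewrite !inE => /andP[sP /forall_inP sc]; apply/andP; split.
  exact: fintype.subset_trans ts sP.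
apply/forall_inP => x /(fintype.subsetP ts)/sc/forall_inP sx; apply/forall_inP => y.
by move=> /(fintype.subsetP ts)/sx.
Qed.

Lemma spans_order_complex P s : spans (order_complex P) s <->
  {subset s <= P} /\ {in s &, forall x y, x >=< y}.
Proof.
rewrite /spans inE; split=> [/andP[/fintype.subsetP sP /forall_inP sc]|[sP sc]].
  split=> [x xs|x y xs ys]; first by apply: sP; rewrite inE.
  have xs' : x \in finset (mem s) by rewrite inE.
  by have /forall_inP/(_ y) := sc x xs'; apply; rewrite inE.
apply/andP; split; first by apply/fintype.subsetP => x; rewrite inE; apply: sP.
by apply/forall_inP => x; rewrite inE => xs; apply/forall_inP => y; rewrite inE; apply: sc.
Qed.

Lemma chain_min s : (0 < size s)%N -> {in s &, forall x y, x >=< y} ->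
  exists2 m, m \in s & forall x, x \in s -> m <= x.
Proof.
elim: s => // x [|y s] IHs _ sc.
  by exists x; rewrite ?mem_head // => z; rewrite inE => /eqP ->.
have [//|u v us vs|m ms mmin] := IHs; first by apply: sc; rewrite inE ?us ?vs orbT.
have /orP[xm|mx] : (x <= m) || (m <= x) by apply: sc; rewrite ?mem_head // inE ms orbT.
  exists x; first exact: mem_head.
  by move=> z; rewrite inE => /predU1P[->//|/mmin]; apply: le_trans.
exists m; first by rewrite inE ms orbT.
by move=> z; rewrite inE => /predU1P[->//|/mmin].
Qed.

Lemma sorted_comparable s : sorted (fun x y => x < y) s -> {in s &, forall x y, x >=< y}.
Proof.
elim: s => // z s IHs; rewrite /= path_sortedE; last exact: lt_trans.
move=> /andP[/allP zs /IHs sc] x y; rewrite !inE.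
move=> /predU1P[->|xs] /predU1P[->|ys]; [exact: comparablexx| | |exact: sc].
  by apply: lt_comparable; apply: zs.
by apply: gt_comparable; apply: zs.
Qed.

Definition chains P : seq T -> Prop := strict_seqs (fun x y => x < y) (fun x => x \in P).

Lemma closed_chains P : closed_under_faces (chains P).
Proof. by apply: closed_strict_seqs; apply: lt_trans. Qed.

Lemma acyclic_chains P m k : m \in P -> (forall x, x \in P -> m <= x) ->
  acyclic_at (chains P) k.
Proof.
move=> mP mmin; apply: (@acyclic_strict_seqs _ _ _ _ _ m) => // [|x /mmin]; first exact: lt_trans.
by rewrite le_eqVlt => /predU1P[->|]; [left|right].
Qed.

Lemma rank_min s : (0 < size s)%N ->
  exists2 m, m \in s & forall x, x \in s -> x = m \/ rank_lt m x.
Proof.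
elim: s => // x [|y s] IHs _.
  by exists x; rewrite ?mem_head // => z; rewrite inE => /eqP ->; left.
have [//|m ms mmin] := IHs.
have [xm|[xm|mx]] := rank_lt_total x m.
- exists x; first exact: mem_head.
  by rewrite xm => z; rewrite inE => /predU1P[|/mmin //]; left.
- exists x; first exact: mem_head.
  move=> z; rewrite inE => /predU1P[|/mmin[->|mz]]; [by left|by right|right].
  exact: rank_lt_trans mz.
- exists m; first by rewrite inE ms orbT.
  by move=> z; rewrite inE => /predU1P[->|/mmin //]; right.
Qed.

(** The two complexes order the vertices of a simplex differently. Carriers avoid the signs of the
    reorderings: a simplex is carried by all increasing sequences of its vertices, a cone over the
    least vertex for either order. *)
Lemma chains_oriented P k : acyclic_at (chains P) k ->
  acyclic_at (oriented_seqs (order_complex P)) k.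
Proof.
have clK := @sub_closed_order_complex P.
have clO : closed_under_faces (oriented_seqs (order_complex P)).
  move=> s t ts [ss Ks]; split; last exact: closed_spans Ks.
  exact: (subseq_sorted (@rank_lt_trans _)) ss.
have subO s u : oriented_seqs (order_complex P) s ->
    strict_seqs (@rank_lt T) (fun x => x \in s) u -> oriented_seqs (order_complex P) u.
  move=> [_ /spans_order_complex[sP sc]] [us su]; split=> //; apply/spans_order_complex.
  by split=> [x /us/sP //|x y /us xs /us ys]; apply: sc.
apply: (@carrier_transfer T T _ _ _
  (fun s => strict_seqs (fun x y => x < y) (fun x => x \in s))
  (fun t => strict_seqs (@rank_lt T) (fun x => x \in t))
  (fun s => strict_seqs (@rank_lt T) (fun x => x \in s))).
- exact: clO.
- exact: closed_chains.
- move=> s t [_ /spans_order_complex[sP _]] [ts st].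
  by split; split=> // x /ts/sP.
- by move=> s t u _ ts [ut su]; split=> // x /ut/(mem_subseq ts).
- by [].
- move=> s [_ /spans_order_complex[_ sc]] /andP[s0 _].
  have [m ms mmin] := chain_min s0 sc.
  apply: (@acyclic_strict_seqs _ _ _ _ _ m) => // [|x /mmin]; first exact: lt_trans.
  by rewrite le_eqVlt => /predU1P[->|]; [left|right].
- move=> t s [tP tsort] [st ss]; split=> //; apply/spans_order_complex.
  split=> [x /st/tP //|x y /st xt /st yt].
  exact: (sorted_comparable tsort).
- by move=> s t u _ ts [ut su]; split=> // x /ut/(mem_subseq ts).
- by [].
- move=> t _ /andP[t0 _]; have [m mt mmin] := rank_min t0.
  apply: (@acyclic_strict_seqs _ _ _ _ _ m) => //.
  + exact: rank_lt_trans.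
  + exact: rank_lt_irr.
- exact: subO.
- by move=> s t u _ ts [ut su]; split=> // x /ut/(mem_subseq ts).
- by move=> s [ss _]; split.
- by move=> s t u _ [ts _] [ut su]; split=> // x /ut/ts.
- move=> t _ /andP[t0 _]; have [m mt mmin] := rank_min t0.
  apply: (@acyclic_strict_seqs _ _ _ _ _ m) => //.
  + exact: rank_lt_trans.
  + exact: rank_lt_irr.
Qed.

End Poset.


(** * Links in open intervals as joins *)

Section Links.
Variables (d : Order.disp_t) (T : finPOrderType d).
Implicit Types (P : {set T}) (s t : seq T) (X Y Z : T).

(** Homology vanishes below the top degree. An arbitrary chain [t] replaces the height, which makes
    the condition easy to split along joins. *)
Definition spherical P : Prop :=
  forall t k, chains P t -> (k < size t)%N -> acyclic_at (chains P) k.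

Definition interval_link X s Y : {set T} :=
  [set z | [&& X < z, z < Y, z \notin s & all (fun x => z >=< x) s]]%SET.

Lemma sorted_split Z t : sorted (fun x y => x < y) t -> {in t, forall x, x >=< Z} ->
  t = [seq x <- t | x < Z] ++ [seq x <- t | ~~ (x < Z)].
Proof.
elim: t => // x t IHt /=; rewrite path_sortedE; last exact: lt_trans.
move=> /andP[/allP xt st] tZ; have IH : t = [seq x <- t | x < Z] ++ [seq x <- t | ~~ (x < Z)].
  by apply: IHt => // y yt; apply: tZ; rewrite inE yt orbT.
case: ifP => xZ /=; first by congr (_ :: _).
have Zx : Z <= x.
  have := tZ x (mem_head x t); rewrite /Order.comparable => /orP[|//].
  by rewrite le_eqVlt xZ orbF => /eqP ->.
have tnZ : all (fun y => ~~ (y < Z)) t.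
  by apply/allP => y /xt xy; rewrite lt_gtF // (le_lt_trans Zx).
have -> : [seq y <- t | y < Z] = [::].
  by apply/eqP; rewrite -(negbK (_ == _)) -has_filter -all_predC.
by move/all_filterP: tnZ => ->.
Qed.

(** An element comparable with [Z] and distinct from it lies on one side of it, so a chain of the
    link is cut at [Z]. This peels one factor off the join. *)
Lemma chains_link_cons X Z s Y : path (fun x y => x < y) X (Z :: s) ->
  all (fun x => x < Y) (Z :: s) ->
  chains (interval_link X (Z :: s) Y) = (fun t => exists t1 t2,
    [/\ t = t1 ++ t2, chains (open_interval X Z) t1 & chains (interval_link Z s Y) t2]).
Proof.
rewrite /= path_sortedE; last exact: lt_trans.
move=> /andP[XZ /andP[/allP Zs ss]] /andP[ZY /allP sY].
apply/funext => t; apply/propext; split=> [[tA st]|[t1 [t2 [-> [t1A st1] [t2A st2]]]]].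
  exists [seq x <- t | x < Z], [seq x <- t | ~~ (x < Z)]; split.
  - apply: sorted_split => // x /tA; rewrite inE.
    by case/and4P => _ _ _ /= /andP[].
  - split; last by apply: (subseq_sorted (@lt_trans _ _)) st; apply: filter_subseq.
    by move=> x; rewrite mem_filter inE => /andP[-> /tA]; rewrite inE => /and4P[->].
  - split; last by apply: (subseq_sorted (@lt_trans _ _)) st; apply: filter_subseq.
    move=> x; rewrite mem_filter inE => /andP[xZ /tA]; rewrite inE => /and4P[_ -> xn].
    rewrite /= => /andP[xcZ ->]; move: xn; rewrite inE negb_or => /andP[xnZ ->].
    rewrite !andbT; move: xcZ; rewrite /Order.comparable le_eqVlt (negbTE xnZ) (negbTE xZ) /=.
    by rewrite le_eqVlt eq_sym (negbTE xnZ).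
have lo x : x \in t1 -> x < Z by move/t1A; rewrite inE => /andP[].
have hi x : x \in t2 -> Z < x by move/t2A; rewrite inE => /and4P[].
split=> [x|].
  rewrite mem_cat inE => /orP[xt|xt] /=.
    move: (t1A x xt); rewrite inE => /andP[Xx xZ]; rewrite Xx (lt_trans xZ ZY) /=.
    rewrite inE negb_or lt_eqF //= (lt_comparable xZ) /=; apply/andP; split.
      by apply/negP => /Zs /(lt_trans xZ); rewrite ltxx.
    by apply/allP => y /Zs Zy; apply: lt_comparable; apply: lt_trans Zy.
  move: (t2A x xt); rewrite inE => /and4P[Zx xY xs xcs].
  by rewrite (lt_trans XZ Zx) xY inE negb_or gt_eqF //= xs (gt_comparable Zx) xcs.
elim: {t1A} t1 lo st1 => //= x t1 IHt lo; rewrite !path_sortedE; try exact: lt_trans.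
move=> /andP[/allP xt1 st1]; rewrite IHt // ?andbT; last first.
  by move=> y yt; apply: lo; rewrite inE yt orbT.
apply/allP => y; rewrite mem_cat => /orP[/xt1 //|/hi]; apply: lt_trans.
by apply: lo; rewrite mem_head.
Qed.

(** The witness chain is cut into chains of the two factors; their sizes add up, exactly as the
    acyclic ranges do in a join. *)
Lemma spherical_link X s Y : (forall Z Z', spherical (open_interval Z Z')) ->
  path (fun x y => x < y) X s -> all (fun x => x < Y) s ->
  spherical (interval_link X s Y).
Proof.
move=> sph; elim: s X => [|Z s IHs] X Xs sY.
  have -> : interval_link X [::] Y = open_interval X Y.
    by apply/setP => z; rewrite !inE /= andbT.
  exact: sph.
move=> t k; rewrite chains_link_cons // => -[t1 [t2 [-> ct1 ct2]]]; rewrite size_cat => kt.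
move: Xs sY => /= /andP[XZ Zs] /andP[ZY sY].
apply: (@join_acyclic _ (fun x => x < Z) (chains (open_interval X Z))
  (chains (interval_link Z s Y)) (size t1) (size t2)) => //.
- exact: closed_chains.
- exact: closed_chains.
- by move=> u [uA _]; apply/allP => x /uA; rewrite inE => /andP[].
- move=> u [uA _]; apply/allP => x /uA; rewrite inE => /and4P[Zx _ _ _] /=.
  by apply/negP => /(lt_trans Zx); rewrite ltxx.
- by move=> j jt; apply: sph ct1 jt.
- by move=> j jt; apply: IHs ct2 jt.
Qed.

Lemma Cohen_Macaulay_interval X Y : (forall Z Z', spherical (open_interval Z Z')) ->
  Cohen_Macaulay (open_interval X Y).
Proof.
move=> sph s sK q qdim.
have [sQ sc] : {subset s <= open_interval X Y} /\ {in s &, forall x y, x >=< y}.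
  move: sK; rewrite inE => /andP[/fintype.subsetP sQ /forall_inP sc]; split=> // x y xs ys.
  by have /forall_inP := sc x xs; apply.
pose l := sort (fun x y => x <= y) (enum s).
have ml : l =i s by move=> x; rewrite mem_sort mem_enum.
have sl : sorted (fun x y => x < y) l.
  rewrite lt_sorted_uniq_le sort_uniq enum_uniq /=.
  apply: (@sort_sorted_in _ (fun x => x \in s)) => [x y xs ys|]; first exact: sc.
  by apply/allP => x; rewrite mem_enum.
have lQ x : x \in l -> X < x < Y by rewrite ml => /sQ; rewrite inE.
have Xl : path (fun x y => x < y) X l.
  rewrite path_sortedE ?sl ?andbT; last exact: lt_trans.
  by apply/allP => x /lQ/andP[].
have lY : all (fun x => x < Y) l by apply/allP => x /lQ/andP[].
have linkE : link (order_complex (open_interval X Y)) s = order_complex (interval_link X l Y).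
  apply/setP => t; rewrite !inE; apply/idP/idP.
    move=> /andP[dts /andP[/fintype.subsetP stQ /forall_inP stc]].
    have stc' x y : x \in s :|: t -> y \in s :|: t -> x >=< y.
      by move=> xs ys; have /forall_inP := stc x xs; apply.
    apply/andP; split; last first.
      apply/forall_inP => x xt; apply/forall_inP => y yt.
      by apply: stc'; rewrite inE ?xt ?yt orbT.
    apply/fintype.subsetP => x xt; rewrite inE.
    have := stQ x; rewrite !inE xt orbT => /(_ isT)/andP[-> ->] /=.
    rewrite ml (disjointFr dts xt) /=; apply/allP => y; rewrite ml => ys.
    by apply: stc'; rewrite inE ?xt ?ys ?orbT.
  move=> /andP[/fintype.subsetP tA /forall_inP tc].
  apply/andP; split.
    rewrite finset.disjoints_subset; apply/fintype.subsetP => x /tA; rewrite !inE ml.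
    by case/and4P.
  apply/andP; split.
    rewrite finset.subUset; apply/andP; split; first by apply/fintype.subsetP.
    by apply/fintype.subsetP => x /tA; rewrite !inE => /and4P[-> ->].
  have ts x y : x \in t -> y \in s -> x >=< y.
    by move/tA; rewrite inE => /and4P[_ _ _ /allP h] ys; apply: h; rewrite ml.
  apply/forall_inP => x; rewrite inE => xst; apply/forall_inP => y; rewrite inE => yst.
  case/orP: xst => xst; case/orP: yst => yst.
  - exact: sc.
  - by rewrite comparable_sym; apply: ts.
  - exact: ts.
  - by have /forall_inP := tc x xst; apply.
rewrite linkE in qdim *.
have clI := @sub_closed_order_complex _ T (interval_link X l Y).
(* In degrees below -1 there is no simplex, so the cycle is zero. *)
have [q0|q0] := ltP q (-1)%R.
  move=> c Kc bdc; exists 0%R.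
    by move=> u; rewrite ffunE eqxx.
  apply/ffunP => u; rewrite !ffunE big1 => [|v _]; last by rewrite ffunE mulr0.
  apply/esym/eqP; apply: contraT => /Kc[_] E; move: q0.
  by rewrite -(ltrD2r 1%R) -E addNr.
have [k qk] : exists k : nat, q = (k%:Z - 1)%R.
  have : (0 <= q + 1)%R by rewrite -lerBlDr sub0r.
  by case E : (q + 1)%R => [k|//] _; exists k; rewrite -E addrK.
(* A degree below the dimension of the link is one for which some simplex has more than k vertices;
   sorted, that simplex is the chain required by [spherical]. *)
have [t tI kt] : exists2 t, t \in order_complex (interval_link X l Y) & (k < #|t|)%N.
  apply/exists_inP; apply: contraTT qdim => /exists_inPn h.
  rewrite -leNgt qk /dim_complex lerD2r lez_nat; apply/bigmax_leqP => t tI.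
  by rewrite leqNgt h.
rewrite qk; apply: acyclic_reduced_homology => //; apply: chains_oriented.
have [tA tc] : {subset t <= interval_link X l Y} /\ {in t &, forall x y, x >=< y}.
  move: tI; rewrite inE => /andP[/fintype.subsetP tQ /forall_inP tc]; split=> // x y xs ys.
  by have /forall_inP := tc x xs; apply.
apply: (spherical_link sph Xl lY (t := sort (fun x y => x <= y) (enum t))); last first.
  by rewrite size_sort -cardE.
split; first by move=> x; rewrite mem_sort mem_enum => /tA.
rewrite lt_sorted_uniq_le sort_uniq enum_uniq /=.
apply: (@sort_sorted_in _ (fun x => x \in t)) => [x y xs ys|]; first exact: tc.
by apply/allP => x; rewrite mem_enum.
Qed.

End Links.

End OrderComplexes.

(** * The lattice of principal left ideals *)


Section LeftRegularBand.
Local Open Scope order_scope.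
Variables (d : Order.disp_t) (B : finLRBType d).
Implicit Types (a b c x y : B) (X Y Z : Lambda B).

Lemma mem_left_ideal b x : (x \in left_ideal b) = ((x * b)%g == x).
Proof.
apply/imsetP/eqP => [[z _ ->]|<-]; last by exists x.
by rewrite -mulgA lrb_mulxx.
Qed.

Lemma left_ideal_sub a b : (left_ideal a \subset left_ideal b) = ((a * b)%g == a).
Proof.
apply/fintype.subsetP/eqP => [ab|ab x].
  by apply/eqP; rewrite -mem_left_ideal; apply: ab; rewrite mem_left_ideal lrb_mulxx.
by rewrite !mem_left_ideal => /eqP <-; rewrite -mulgA ab.
Qed.

Fact Lambda_of_subproof b : left_ideal b \in [set left_ideal b | b in [set: B]%SET]%SET.
Proof. by apply/imsetP; exists b. Qed.

Definition Lambda_of b : Lambda B := MkLambda (Lambda_of_subproof b).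

Lemma Lambda_ofP X : exists b, X = Lambda_of b.
Proof.
by case: X => A AB; have /imsetP[b _ Ab] := AB; exists b; apply: val_inj.
Qed.

Lemma Lambda_le a b : (Lambda_of a <= Lambda_of b) = ((a * b)%g == a).
Proof. exact: left_ideal_sub. Qed.

Lemma mem_LRB_ge X b : (b \in LRB_ge X) = (X <= Lambda_of b).
Proof. by rewrite inE. Qed.

Lemma Lambda_of_le a b : a <= b -> Lambda_of a <= Lambda_of b.
Proof.
rewrite lrb_leE Lambda_le => /eqP ba.
by rewrite -{1}ba lrb_mulxyx ba.
Qed.

(** If both generate the same left ideal, then [b * a] equals a by the order and b by the ideals.
    Elements with a common left ideal thus form an antichain. *)
Lemma Lambda_of_lt a b : a < b -> Lambda_of a < Lambda_of b.
Proof.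
move=> ab; rewrite lt_neqAle Lambda_of_le ?andbT ?(ltW ab) //.
apply: contraTneq ab => E; have : Lambda_of b <= Lambda_of a by rewrite E.
by rewrite Lambda_le lt_leAnge lrb_leE => /eqP ->; case: eqP => // <-; rewrite lexx.
Qed.

(** The product [y * z] is below y by idempotence, and it generates the same left ideal as z because
    [z * y = z]. *)
Lemma Lambda_lift y Z : Z < Lambda_of y -> exists2 b, Lambda_of b = Z & b < y.
Proof.
have [z ->] := Lambda_ofP Z; move=> zy; have := ltW zy; rewrite Lambda_le => /eqP zyz.
have Eyz : Lambda_of (y * z)%g = Lambda_of z.
  apply/le_anti; rewrite !Lambda_le; apply/andP; split.
    by rewrite -mulgA lrb_mulxx.
  by rewrite mulgA zyz lrb_mulxx.
exists (y * z)%g => //; rewrite lt_neqAle; apply/andP; split.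
  by apply: contraTneq zy => E; rewrite -Eyz E ltxx.
by rewrite lrb_leE mulgA lrb_mulxx.
Qed.

Lemma Lambda_lift_chain y s : path (fun X Y => Y < X) (Lambda_of y) s ->
  exists2 t, path (fun a b => b < a) y t & map Lambda_of t = s.
Proof.
elim: s y => [|Z s IHs] y; first by exists [::].
move=> /= /andP[/Lambda_lift[b <- by_] /IHs[t bt <-]].
by exists (b :: t) => //=; rewrite by_.
Qed.

Definition below y X : {set B} := lower_lt (LRB_ge X) y.

Lemma mem_below y X b : (b \in below y X) = (X <= Lambda_of b) && (b < y).
Proof. by rewrite inE mem_LRB_ge. Qed.

Definition below_strict y X : {set B} := [set b | (X < Lambda_of b) && (b < y)]%SET.

(** * The fibres and the main acyclicity statement *)

Section CW.
Variables (R : realType) (cwB : CW_LRB R B).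

Lemma below_sphere y X : X <= Lambda_of y ->
  exists n, homeomorphic (realization R (order_complex (below y X))) (@unit_sphere R n).
Proof.
move=> Xy; have [_ /(_ y)] := cwB X; rewrite mem_LRB_ge => /(_ Xy)[n _ H].
by exists n.
Qed.

(** Lifted chains supply the simplex whose size bounds the acyclic range of the sphere
    [below y X]. *)
Lemma lift_simplex y X s : path (fun Y Z => Z < Y) (Lambda_of y) s -> all (>= X) s ->
  exists2 tau, tau \in order_complex (below y X) & #|tau| = size s.
Proof.
move=> /Lambda_lift_chain[t yt <-] /allP sX; exists (finset (mem t)).
  apply/spans_order_complex.
  move: yt; rewrite path_sortedE => [|a b c ab /lt_trans]; last exact.
  move=> /andP[/allP ty st]; split=> [b bt|a b at_ bt].
    by rewrite mem_below ty // sX // map_f.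
  rewrite -rev_sorted in st.
  by apply: (sorted_comparable st); rewrite mem_rev.
have ut : uniq t.
  have : sorted (fun a b => b < a) t by apply: path_sorted yt.
  by rewrite -rev_sorted => /lt_sorted_uniq; rewrite rev_uniq.
by rewrite cardsE size_map; apply/card_uniqP.
Qed.

Lemma acyclic_below y X s k : X <= Lambda_of y ->
  path (fun Y Z => Z < Y) (Lambda_of y) s -> all (>= X) s -> (k < size s)%N ->
  acyclic_at (spans (order_complex (below y X))) k.
Proof.
move=> Xy ys sX ks; have [n sphere] := below_sphere Xy.
have [tau tauK szt] := lift_simplex ys sX; rewrite -szt in ks.
by apply: (acyclic_sphere _ sphere tauK ks); apply: sub_closed_order_complex.
Qed.

Lemma acyclic_below_strict y X s k : X < Lambda_of y ->
  path (fun Y Z => Z < Y) (Lambda_of y) s -> all (> X) s -> (k < size s)%N ->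
  acyclic_at (spans (order_complex (below_strict y X))) k.
Proof.
move=> Xy ys sX ks; have [n sphere] := below_sphere (ltW Xy).
(* [X] is added at the bottom of the chain, since the sphere contains lifts of [X]. The additional
   vertex pays for the degree lost in [acyclic_avoid]. *)
have [||tau tauK szt] := @lift_simplex y X (rcons s X).
- rewrite rcons_path ys /=; case: s sX {ys ks} => //= Z s /andP[ZX sX].
  have /allP := sX; case/lastP: s sX => // s Z' + h; rewrite last_rcons => _.
  by apply: h; rewrite mem_rcons mem_head.
- by rewrite all_rcons lexx; apply: sub_all sX => Z; apply: ltW.
pose l := enum [set b in below y X | Lambda_of b == X]%SET.
have -> : order_complex (below_strict y X) = avoid (order_complex (below y X)) l.
  apply/setP => t; rewrite !inE.
  apply/andP/andP => [[/fintype.subsetP tA tc]|[/andP[/fintype.subsetP tA tc] /allP tl]].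
    split.
      rewrite tc andbT; apply/fintype.subsetP => b /tA; rewrite inE mem_below.
      by move=> /andP[/ltW -> ->].
    apply/allP => b; rewrite mem_enum inE => /andP[_ /eqP bX].
    by apply/negP => /tA; rewrite inE bX ltxx.
  split=> //; apply/fintype.subsetP => b bt; have := tA b bt; rewrite mem_below inE.
  move=> /andP[Xb by_]; rewrite by_ andbT lt_neqAle Xb andbT.
  apply: contraL bt => /eqP bX; apply: tl; rewrite mem_enum inE mem_below Xb by_ /=.
  by rewrite bX.
apply: (acyclic_avoid _ sphere tauK).
- exact: sub_closed_order_complex.
- move=> b; rewrite mem_enum !inE => /andP[/andP[Xb by_] _].
  rewrite finset.sub1set !inE Xb by_ /=; apply/forall_inP => x /set1P ->.
  by apply/forall_inP => z /set1P ->; apply: comparablexx.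
- exact: enum_uniq.
- move=> t; rewrite inE => /andP[_ /forall_inP tc] b c.
  rewrite !mem_enum !inE => /andP[_ /eqP bX] /andP[_ /eqP cX] bt ct.
  have /forall_inP/(_ _ ct) := tc _ bt; rewrite /Order.comparable !le_eqVlt.
  by case/orP => /predU1P[//|/Lambda_of_lt]; rewrite bX cX ltxx.
- by rewrite szt size_rcons ltnS.
Qed.

Theorem spherical_Lambda X Y : spherical (open_interval X Y).
Proof.
move=> s0 k [s0A ss0] ks0.
have [y Ey] := Lambda_ofP Y; subst Y.
have clI := @closed_chains _ _ (open_interval X (Lambda_of y)).
have below_path s : chains (open_interval X (Lambda_of y)) s ->
    path (fun Y Z => Z < Y) (Lambda_of y) (rev s).
  move=> [sA ss]; rewrite path_sortedE => [|a b c ab /lt_trans]; last exact.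
  rewrite rev_sorted ss andbT all_rev; apply/allP => Z /sA; rewrite inE.
  by case/andP.
have Xy : X < Lambda_of y.
  case: s0 s0A {ss0} ks0 => // Z s0 /(_ Z (mem_head _ _)); rewrite inE => /andP[XZ Zy] _.
  exact: lt_trans Zy.
have clT := closed_spans (@sub_closed_order_complex _ _ (below_strict y X)).
have head_le (Z : Lambda B) s : sorted (fun X Y => X < Y) (Z :: s) -> forall W, W \in Z :: s -> Z <= W.
  rewrite /= path_sortedE => [/andP[/allP Zs _] W|]; last exact: lt_trans.
  by rewrite inE => /predU1P[->//|/Zs/ltW].
have sub_head (Z Z' : Lambda B) s s' : sorted (fun X Y => X < Y) (Z :: s) ->
    subseq (Z' :: s') (Z :: s) -> Z <= Z'.
  by move=> ss /mem_subseq/(_ Z' (mem_head _ _)); apply: head_le.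
(* A chain with minimum [Z] is carried by the fibre over the elements above
   [Z]. *)
pose Phi (s : seq (Lambda B)) : seq B -> Prop :=
  if s is Z :: _ then spans (order_complex (below y Z)) else fun t => t = [::].
(* Going to the fibre over the elements above [Z] and back stays above [Z], so the homotopy takes
   place in a cone with apex [Z]. *)
pose Theta (s : seq (Lambda B)) : seq (Lambda B) -> Prop :=
  if s is Z :: _ then chains [set W in open_interval X (Lambda_of y) | Z <= W]%SET
  else fun t => t = [::].
have spans_nil (P : {set B}) : spans (order_complex P) [::].
  by apply/spans_order_complex; split.
apply: (@carrier_transfer _ _ _ (spans (order_complex (below_strict y X)))
  (spans (order_complex (below_strict y X))) Phi
  (fun t => strict_seqs (fun Y Z => Y < Z) (fun Z => Z \in map Lambda_of t)) Theta) => //.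
- case=> [|Z s] t [sA ss] /=; first by move=> ->; split; apply: spans_nil.
  move=> /spans_order_complex[tZ tc]; suff H : spans (order_complex (below_strict y X)) t by [].
  apply/spans_order_complex; split=> // b /tZ; rewrite mem_below inE => /andP[Zb ->].
  have := sA Z (mem_head _ _); rewrite inE => /andP[XZ _].
  by rewrite (lt_le_trans XZ Zb).
- case=> [|Z s] [|Z' s'] u [sA ss] //= ts; first by move=> ->; apply: spans_nil.
  move=> /spans_order_complex[uZ uc]; apply/spans_order_complex; split=> // b /uZ.
  rewrite !mem_below => /andP[Zb ->]; rewrite andbT; apply: le_trans Zb.
  exact: (sub_head _ _ _ _ ss ts).
(* The chain is its own witness: reversed, it descends from [y] to its minimum [Z], and its lift is
   a simplex of the fibre with as many vertices as the chain. *)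
- case=> // Z s cs _ /=; have [sA ss] := cs.
  apply: (acyclic_below _ (below_path _ cs)).
  + by have := sA Z (mem_head _ _); rewrite inE => /andP[_ /ltW].
  + by rewrite all_rev; apply/allP => W; apply: head_le.
  + by rewrite size_rev.
- move=> t s /spans_order_complex[tA tc] [st ss]; split=> // Z /st/mapP[b /tA + ->].
  by rewrite !inE => /andP[-> /Lambda_of_lt].
- move=> s t u _ /mem_subseq ts [ut su]; split=> // Z /ut/mapP[b /ts bs ->].
  exact: map_f.
- move=> t /spans_order_complex[tA tc] /andP[t0 _].
  have [||m mt mmin] := @chain_min _ _ (map Lambda_of t).
  + by rewrite size_map.
  + move=> _ _ /mapP[a at_ ->] /mapP[b bt ->]; rewrite /Order.comparable.
    by case/orP: (tc a b at_ bt) => /Lambda_of_le ->; rewrite ?orbT.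
  apply: (@acyclic_strict_seqs _ _ _ _ _ m) => // [|Z /mmin]; first exact: lt_trans.
  by rewrite le_eqVlt => /predU1P[->|]; [left|right].
- case=> [|Z s] u _ /=; first by move=> ->.
  by move=> [uA su]; split=> // W /uA; rewrite !inE => /andP[].
- case=> [|Z s] [|Z' s'] u [sA ss] //= ts; first by move=> ->.
  move=> [uA su]; split=> // W /uA; rewrite !inE => /andP[-> /=]; apply: le_trans.
  exact: (sub_head _ _ _ _ ss ts).
- case=> // Z s [sA ss]; split=> // W Ws; rewrite inE sA //=.
  exact: (head_le _ _ ss).
- case=> [|Z s] t u [sA ss] /=.
    by move=> ->; case: u => // W u [/(_ W (mem_head _ _))].
  move=> /spans_order_complex[tZ _] [ut su]; split=> // W /ut/mapP[b /tZ + ->].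
  rewrite mem_below => /andP[Zb by_]; rewrite !inE Zb (Lambda_of_lt by_) !andbT.
  apply: lt_le_trans Zb; have := sA Z (mem_head _ _); rewrite inE; by case/andP.
- case=> // Z s [sA ss] _ /=; apply: (@acyclic_chains _ _ _ Z).
    by rewrite inE sA ?mem_head //=.
  by move=> W; rewrite inE => /andP[].
- apply: (@acyclic_below_strict _ _ (rev s0)) => //; first exact: below_path.
  + by rewrite all_rev; apply/allP => Z /s0A; rewrite inE => /andP[].
  + by rewrite size_rev.
Qed.

End CW.

Lemma Lambda_meet a b : Lambda_of (a * b)%g <= Lambda_of a.
Proof. by rewrite Lambda_le lrb_mulxyx. Qed.

Lemma Lambda_meetr a b : Lambda_of (a * b)%g <= Lambda_of b.
Proof. by rewrite Lambda_le -mulgA lrb_mulxx. Qed.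

(** The ideal of a product lies in those of both factors. An ideal of least cardinality therefore
    equals that of [b * c], and lies in that of c. *)
Lemma Lambda_has_min : B -> exists X, forall Y, X <= Y.
Proof.
move=> b0.
have [b _ bmin] := @arg_minnP B b0 xpredT (fun b => #|left_ideal b|) isT.
exists (Lambda_of b) => Y; have [c ->] := Lambda_ofP Y.
suff -> : Lambda_of b = Lambda_of (b * c)%g by apply: Lambda_meetr.
apply/esym/val_inj/eqP; rewrite eqEcard; apply/andP; split; first exact: Lambda_meet.
exact: bmin.
Qed.

End LeftRegularBand.

Theorem theorem7p14 (R : realType) (d : Order.disp_t) (B : finLRBType d)
    (connB : LRB_connected R B) (cwB : CW_LRB R B) :
  (forall X Y : Lambda B, (X < Y)%O -> Cohen_Macaulay (open_interval X Y)) /\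
  ((exists e : B, forall x : B, (e * x)%g = x /\ (x * e)%g = x) ->
   Cohen_Macaulay (proper_part (Lambda B))).
Proof.
have CM (X Y : Lambda B) : Cohen_Macaulay (open_interval X Y).
  by apply: Cohen_Macaulay_interval => Z Z'; apply: (spherical_Lambda cwB).
split=> [X Y _|[e eP]]; first exact: CM.
have [X Xmin] := Lambda_has_min e.
have Ymax Z : (Z <= Lambda_of e)%O.
  by have [b ->] := Lambda_ofP Z; rewrite Lambda_le; have [_ ->] := eP b.
(* The two ends may coincide, which is harmless since [CM] does not assume them distinct. *)
have -> : proper_part (Lambda B) = open_interval X (Lambda_of e); last exact: CM.
apply/setP => Z; rewrite !inE !lt_neqAle Xmin Ymax !andbT eq_sym.
congr (~~ _ && ~~ _); apply/forallP/eqP => [|-> //].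
  by move=> /(_ X) ZX; apply: le_anti; rewrite ZX Xmin.
by move=> /(_ (Lambda_of e)) eZ; apply: le_anti; rewrite eZ Ymax.
Qed.
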